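(* Let $n\ge 1$, let $c>0$, let $(P,g_P)$ be an $(n-1)$-dimensional Riemannian manifold, and let $N=P\times\mathbb{R}$ with metric $g_N=g_P+ds^2$ (so $\dim N=n$). For $\star\in\{II,III\}$ let $X_\star=b_\star(t)\,\partial_t$, a conformal Killing vector field on $\mathcal{RW}(N,g_N,I_\star,b_\star)$. Consider the $X_\star$-solitons which are graphs of functions of the form $$P\times L'\to I_\star,\qquad (p,s)\mapsto f(s),$$ where $L'\subseteq\mathbb{R}$ is an open interval. Then $f$ has to be a solution of the ODE $$f''=\left(1-\frac{f'^2}{(b_\star\circ f)^2}\right)(b_\star\circ f)\,d_\star+\frac{b_\star'\circ f}{b_\star\circ f}\,f'^2 .$$ Denote by $L\subseteq\mathbb{R}$ the maximal interval of definition of such an $f$ as a solution of this ODE with values in $I_\star$, and write $f$ also for this maximal solution. These $X_\star$-solitons are in one, and only one, of the following classes. For $\star=II$: (1) Type II.A: timelike, $L=(-\infty,k)$ or $L=(k,\infty)$ for some $k\in\mathbb{R}$, $f$ blows up to $\pi/2c$ at $k$ and tends asymptotically to $0$ at the other end of $L$. (2) Type II.B: spacelike, $L=\mathbb{R}$, $f$ has a global maximum and tends asymptotically to $0$ at both ends of $L$. (3) Type II.C: spacelike, $L=(-\infty,k)$ or $L=(k,\infty)$ for some $k\in\mathbb{R}$, $f$ blows up to $\pi/2c$ at $k$ and tends asymptotically to $0$ at the other end of $L$. For $\star=III$: (1) Type III.A: timelike, $L=(-\infty,k)$ or $L=(k,\infty)$ for some $k\in\mathbb{R}$, $f$ blows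 up to $-\infty$ at $k$ and tends asymptotically to $0$ at the other end of $L$. (2) Type III.B: spacelike, $L=\mathbb{R}$, $f$ has a global minimum and tends asymptotically to $0$ at both ends of $L$.
   Context: For a Riemannian manifold $(N,g_N)$, an open interval $I\subseteq\mathbb{R}$ and a smooth $b:I\to(0,+\infty)$, the Generalised Robertson-Walker spacetime $\mathcal{RW}(N,g_N,I,b)$ is $M=N\times I$ with the metric $g=b(t)^2g_N-dt^2$, where $t$ is the coordinate in $I$. Warping functions, with $n\ge1$ and $c>0$ fixed: $b_{II}(t)=nc\tan(ct)$ on $I_{II}=(0,\pi/2c)$, with $d_{II}:=b_{II}^2-nb_{II}'=-c^2n^2$; $b_{III}(t)=-nc\tanh(ct)$ on $I_{III}=(-\infty,0)$, with $d_{III}:=b_{III}^2-nb_{III}'=c^2n^2$. $X$-solitons: let $X=b(t)\partial_t$. Its flow is $\Phi_t(x,s)=(x,A(s,t))$ with $A(s,0)=s$, $\frac{\partial A}{\partial t}(s,t)=b(A(s,t))$. For $\Omega\subseteq N$ open and $u\in C^2(\Omega,I)$, put $u_t(x)=A(u(x),t)$ and $F_t(x)=(x,u_t(x))$, for $t$ close enough to $0$ that this is defined. Assume that $F_0^*g$ is non-degenerate. The graph of $u$ (equivalently $F_0$) is an $X$-soliton if for every $x\in\Omega$ and every $t$ in a neighbourhood of $0$ one has $b(u_t(x))\,\partial_t^{\perp}(x,u_t(x))=\vec H_t(x,u_t(x))$, where $\perp$ is the $g$-orthogonal projection to the normal bundle of $F_t$ and $\vec H_t=\sum_i\varepsilon_i\left(\nabla^M_{(F_t)_*e_i}(F_t)_*e_i\right)^\perp$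 is the mean curvature vector of $F_t$; here $(e_i)$ is a local $F_t^*g$-orthonormal frame with $g((F_t)_*e_i,(F_t)_*e_j)=\varepsilon_i\delta_{ij}$, and $\nabla^M$ is the Levi-Civita connection of $(M,g)$. The graph of $(p,s)\mapsto f(s)$ is timelike (respectively spacelike) if $1-f'(s)^2/b_\star(f(s))^2<0$ (respectively $>0$) for all $s$. ''$f$ blows up to $\ell$ at $k$'' means $f(s)\to\ell$ as $s\to k$ within $L$; ''tends asymptotically to $0$'' at an infinite end of $L$ means $f(s)\to 0$ as $s$ tends to that end. *)

(* Defs.v *)
(* Points and tangent vectors of R^m are rows 'rV[R]_m; linear maps act on the
   right, so row i of a Jacobian is the i-th partial derivative. *)
From HB Require Import structures.
From mathcomp Require Import all_boot all_order all_algebra.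
From mathcomp Require Import all_classical all_reals all_analysis.
From mathcomp Require Import ring.

Set Implicit Arguments.
Unset Strict Implicit.
Unset Printing Implicit Defensive.

Import Order.TTheory GRing.Theory Num.Theory.
Import numFieldNormedType.Exports.

Local Open Scope classical_set_scope.
Local Open Scope ring_scope.

Section Calculus.
Context {R : realType}.
Implicit Types m k : nat.

Definition pd {m} (i : 'I_m) (f : 'rV[R]_m -> R) (x : 'rV[R]_m) : R :=
  'D_(delta_mx 0 i) f x.

Fixpoint Ck {m} (k : nat) (D : set 'rV[R]_m) (f : 'rV[R]_m -> R) : Prop :=
  (forall x, D x -> {for x, continuous f}) /\
  (if k is k'.+1 then
     forall i, (forall x, D x -> derivable f x (delta_mx 0 i)) /\
               Ck k' D (pd i f)
   else True).

Definition smooth {m} (D : set 'rV[R]_m) (f : 'rV[R]_m -> R) : Prop :=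
  forall k, Ck k D f.

Definition jac {m k} (F : 'rV[R]_m -> 'rV[R]_k) (x : 'rV[R]_m) : 'M[R]_(m, k) :=
  \matrix_(i, a) pd i (fun y => F y 0 a) x.

Lemma Ck_cst m k (D : set 'rV[R]_m) (a : R) : Ck k D (fun=> a).
Proof.
elim: k a => [|k IH] a /=; first by split => // x _; exact: cst_continuous.
split=> [x _|i]; first exact: cst_continuous.
split=> [x _|]; first exact: derivable_cst.
rewrite (_ : pd i _ = fun=> 0); first exact: IH.
by apply/funext => x; rewrite /pd derive_cst.
Qed.

Lemma Ck_sub m k (D E : set 'rV[R]_m) (f : 'rV[R]_m -> R) :
  D `<=` E -> Ck k E f -> Ck k D f.
Proof.
move=> DE; elim: k f => [|k IH] f [fc fd]; split => //.
- by move=> x /DE; exact: fc.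
- by move=> x /DE; exact: fc.
- by move=> i; split; [move=> x /DE; exact: (fd i).1 | exact: IH (fd i).2].
Qed.

Lemma Ck_eq m k (D : set 'rV[R]_m) (f g : 'rV[R]_m -> R) :
  f =1 g -> Ck k D g -> Ck k D f.
Proof. by move=> /funext ->. Qed.

Lemma derive_along0 m (f : 'rV[R]_m -> R) x :
  derivable f x 0 /\ 'D_0 f x = 0.
Proof.
have E : (fun h : R => h^-1 *: ((f \o shift x) (h *: 0) - f x)) = fun=> 0.
  by apply/funext => h /=; rewrite scaler0 add0r subrr scaler0.
by rewrite /derivable /derive E; split; [exact: is_cvg_cst | exact: lim_cst].
Qed.

Lemma near_dist (V : normedModType R) (z : V) (e : R) :
  0 < e -> \forall w \near z, `|z - w| < e.
Proof. by move=> e0; apply/nbhs_normP; exists e. Qed.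

Lemma lsubmx_continuous m k : continuous (@lsubmx R 1 m k).
Proof.
move=> z; have FF : Filter (nbhs z) by exact: nbhs_filter.
apply/cvgrPdist_lt => e e0; apply: filterS (near_dist z e0) => w.
rewrite /Num.norm /= !mx_normrE => /bigmax_ltP[_ H].
apply/bigmax_ltP; split => // -[a b] _.
by have := H (a, lshift k b) isT; rewrite /= !mxE.
Qed.

Lemma rsubmx_continuous m k : continuous (@rsubmx R 1 m k).
Proof.
move=> z; have FF : Filter (nbhs z) by exact: nbhs_filter.
apply/cvgrPdist_lt => e e0; apply: filterS (near_dist z e0) => w.
rewrite /Num.norm /= !mx_normrE => /bigmax_ltP[_ H].
apply/bigmax_ltP; split => // -[a b] _.
by have := H (a, rshift m b) isT; rewrite /= !mxE.
Qed.

Lemma derive_lsubmx m k (f : 'rV[R]_m -> R) (z v : 'rV[R]_(m + k)) :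
  (derivable f (lsubmx z) (lsubmx v) -> derivable (f \o lsubmx) z v) /\
  'D_v (f \o lsubmx) z = 'D_(lsubmx v) f (lsubmx z).
Proof.
have E : (fun h : R => h^-1 *: (((f \o lsubmx) \o shift z) (h *: v)
                                - (f \o lsubmx) z)) =
  (fun h : R => h^-1 *: ((f \o shift (lsubmx z)) (h *: lsubmx v)
                         - f (lsubmx z))).
  apply/funext => h /=; congr (_ *: (f _ - _)).
  by apply/rowP => b; rewrite !mxE.
by rewrite /derivable /derive E.
Qed.

Lemma lsubmx_delta m k i :
  lsubmx (delta_mx 0 i : 'rV[R]_(m + k)) =
  match fintype.split i with inl j => delta_mx 0 j | inr _ => 0 end.
Proof.
apply/rowP => b; rewrite !mxE; case: splitP => j ij.
  by rewrite mxE -!val_eqE /= ij.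
rewrite mxE -!val_eqE /= ij; case: eqP => // bk.
by have := ltn_ord b; rewrite bk ltnNge leq_addr.
Qed.

Lemma Ck_lsubmx m k j (D : set 'rV[R]_m) (f : 'rV[R]_m -> R) :
  Ck j D f -> Ck j [set z : 'rV[R]_(m + k) | D (lsubmx z)] (f \o lsubmx).
Proof.
elim: j f => [|j IH] f [fc fd]; (split; first by move=> z Dz;
  apply: continuous_comp; [exact: lsubmx_continuous | exact: fc]) => // i.
have := lsubmx_delta i; case: (fintype.split i) => [a|_] E.
  split=> [z Dz|].
    by apply: (derive_lsubmx f z _).1; rewrite E; apply: (fd a).1.
  rewrite (_ : pd i _ = pd a f \o lsubmx); first exact: IH (fd a).2.
  by apply/funext => z; rewrite /pd (derive_lsubmx f z _).2 E.
split=> [z Dz|].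
  by apply: (derive_lsubmx f z _).1; rewrite E; apply: (derive_along0 _ _).1.
rewrite (_ : pd i _ = fun=> 0); first exact: Ck_cst.
by apply/funext => z; rewrite /pd (derive_lsubmx f z _).2 E (derive_along0 _ _).2.
Qed.

Lemma derive_coord m (a : 'I_m) (z v : 'rV[R]_m) :
  derivable (fun y : 'rV[R]_m => y 0 a) z v /\
  'D_v (fun y : 'rV[R]_m => y 0 a) z = v 0 a.
Proof.
have E : (fun h : R => h^-1 *: (((fun y : 'rV[R]_m => y 0 a) \o shift z) (h *: v)
             - z 0 a)) @ 0^' --> v 0 a.
  apply: (@cvg_trans _ ((fun=> v 0 a) @ (0 : R)^')); last exact: cvg_cst.
  apply: near_eq_cvg; near=> h => /=.
  rewrite !mxE addrK scalerA mulVf ?scale1r //.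
  by near: h; exact: nbhs_dnbhs_neq.
split; first by apply/cvg_ex; exists (v 0 a).
exact/cvg_lim.
Unshelve. all: by end_near. Qed.

Lemma smooth_coord m (a : 'I_m) (D : set 'rV[R]_m) :
  smooth D (fun y : 'rV[R]_m => y 0 a).
Proof.
move=> j; have C x : {for x, continuous (fun y : 'rV[R]_m => y 0 a)}.
  exact: coord_continuous.
case: j => [|j]; split => // i; split=> [x _|]; first exact: (derive_coord _ _ _).1.
rewrite (_ : pd i _ = fun=> (delta_mx 0 i : 'rV[R]_m) 0 a); first exact: Ck_cst.
by apply/funext => x; rewrite /pd (derive_coord _ _ _).2.
Qed.

Lemma jac_row_mx m k (T : 'rV[R]_m -> 'rV[R]_k) (z : 'rV[R]_(m + 1)) :
  jac (fun y : 'rV[R]_(m + 1) => row_mx (T (lsubmx y)) (rsubmx y)) z =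
  block_mx (jac T (lsubmx z)) 0 0 1%:M.
Proof.
have HL j : (fun y : 'rV[R]_(m + 1) => row_mx (T (lsubmx y)) (rsubmx y) 0 (lshift 1 j))
    = (fun y => T y 0 j) \o lsubmx.
  by apply/funext => y /=; rewrite row_mxEl.
have HR j : (fun y : 'rV[R]_(m + 1) => row_mx (T (lsubmx y)) (rsubmx y) 0 (rshift k j))
    = (fun y => y 0 (rshift m j)).
  by apply/funext => y /=; rewrite row_mxEr mxE.
rewrite -[LHS]submxK; congr block_mx; apply/matrixP => i j; rewrite !mxE /pd ?HL ?HR.
- by rewrite (derive_lsubmx _ _ _).2 lsubmx_delta (unsplitK (inl i)).
- rewrite (derive_coord _ _ _).2 !mxE -!val_eqE /= eq_sym ltn_eqF ?andbF //.
  by rewrite (leq_trans (ltn_ord i)) ?leq_addr.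
- by rewrite (derive_lsubmx _ _ _).2 lsubmx_delta (unsplitK (inr i))
    (derive_along0 _ _).2.
- by rewrite (derive_coord _ _ _).2 !mxE !ord1 !eqxx.
Qed.

End Calculus.

(* The atlas is indexed by [chart]; chart c is phi_c = chart_map c on
   U_c = chart_dom c, with inverse chart_inv c, and chart_metric c is the matrix
   of the metric on phi_c(U_c).  The values of these total functions outside
   U_c or phi_c(U_c) are irrelevant. *)
Record riemannianManifold (R : realType) (m : nat) := RiemannianManifold {
  carrier :> topologicalType;
  hausdorff_carrier : hausdorff_space carrier;
  second_countable_carrier : @second_countable carrier;
  chart : Type;
  chart_dom : chart -> set carrier;
  chart_map : chart -> carrier -> 'rV[R]_m;
  chart_inv : chart -> 'rV[R]_m -> carrier;
  chart_metric : chart -> 'rV[R]_m -> 'M[R]_m;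
  dom_cover : forall x, exists c, chart_dom c x;
  open_dom : forall c, open (chart_dom c);
  open_codom : forall c, open (chart_map c @` chart_dom c);
  coordK : forall c x, chart_dom c x -> chart_inv c (chart_map c x) = x;
  continuous_coord : forall c x, chart_dom c x ->
    {for x, continuous (chart_map c)};
  continuous_param : forall c y, (chart_map c @` chart_dom c) y ->
    {for y, continuous (chart_inv c)};
  smooth_transition : forall c d a,
    smooth (chart_map c @` (chart_dom c `&` chart_dom d))
           (fun y => chart_map d (chart_inv c y) 0 a);
  smooth_metric : forall c i j,
    smooth (chart_map c @` chart_dom c) (fun y => chart_metric c y i j);
  metric_sym : forall c y, (chart_map c @` chart_dom c) y ->
    (chart_metric c y)^T = chart_metric c y;
  metric_pos : forall c y, (chart_map c @` chart_dom c) y ->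
    forall v : 'rV[R]_m, v != 0 -> 0 < (v *m chart_metric c y *m v^T) 0 0;
  metric_change : forall c d x, chart_dom c x -> chart_dom d x ->
    chart_metric c (chart_map c x) =
      jac (chart_map d \o chart_inv c) (chart_map c x)
        *m chart_metric d (chart_map d x)
        *m (jac (chart_map d \o chart_inv c) (chart_map c x))^T
}.

Section ProductWithLine.
Context {R : realType} {m : nat} (P : riemannianManifold R m).

Definition carrierL : topologicalType := (P * R)%type.
Definition domL (c : chart P) : set carrierL := [set x | chart_dom c x.1].
Definition coordL (c : chart P) (x : carrierL) : 'rV[R]_(m + 1) :=
  row_mx (chart_map c x.1) (const_mx x.2).
Definition paramL (c : chart P) (z : 'rV[R]_(m + 1)) : carrierL :=
  (chart_inv c (lsubmx z), z 0 (rshift m ord0)).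
Definition metricL (c : chart P) (z : 'rV[R]_(m + 1)) : 'M[R]_(m + 1) :=
  block_mx (chart_metric c (lsubmx z)) 0 0 1%:M.

Lemma codomLE c :
  coordL c @` domL c = [set z | (chart_map c @` chart_dom c) (lsubmx z)].
Proof.
apply/seteqP; split=> [_ [[x s] /= dx <-]|z /= [x dx xz]].
  by rewrite row_mxKl; exists x.
exists (x, z 0 (rshift m ord0)) => //=.
rewrite /coordL /= xz -[RHS]hsubmxK; congr row_mx.
by apply/rowP => j; rewrite !mxE !ord1.
Qed.

Lemma hausdorffL : hausdorff_space carrierL.
Proof.
move=> [p s] [q t] H; congr pair.
  apply: (@hausdorff_carrier _ _ P) => A B pA qB.
  have [] := H (A `*` setT) (B `*` setT).
  - by exists (A, setT) => //; split => //; exact: filterT.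
  - by exists (B, setT) => //; split => //; exact: filterT.
  by move=> [a x] [[/= Aa _] [/= Ba _]]; exists a.
apply: (@norm_hausdorff R R^o) => A B sA tB.
have [] := H (setT `*` A) (setT `*` B).
- by exists (setT, A) => //; split => //; exact: filterT.
- by exists (setT, B) => //; split => //; exact: filterT.
by move=> [a x] [[/= _ Ax] [/= _ Bx]]; exists x.
Qed.

Lemma second_countableL : @second_countable carrierL.
Proof.
have [B cB [oB bB]] := @second_countable_carrier _ _ P.
pose II (q : rat * rat) : set R := `](ratr q.1), (ratr q.2)[%classic.
exists [set UV | exists2 X : set P * (rat * rat),
    (B `*` setT) X & X.1 `*` II X.2 = UV].
  rewrite (_ : [set _ | _] =
      (fun X : set P * (rat * rat) => X.1 `*` II X.2) @` (B `*` setT)) //.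
  apply: (@card_le_trans _ _ _ (B `*` [set: rat * rat])); first exact: card_image_le.
  by apply: countableX => //; exact: countableP.
split=> [_ [[U q] /= [BU _] <-]|[p s] W [[/= U V] [pU sV] UVW]].
  rewrite openE => -[p s] [/= Up sq]; exists (U, II q) => //=; split.
    by apply: open_nbhs_nbhs; split => //; exact: oB.
  by apply: open_nbhs_nbhs; split => //; exact: interval_open.
have [U' [BU' U'p] U'U] := bB p U pU.
have /nbhs_ballP[e /= e0 eV] := sV.
have [q1 /itvP q1s] : exists q, ratr q \in `](s - e), s[ by
  apply: rat_in_itvoo; rewrite ltrBlDr ltrDl.
have [q2 /itvP q2s] : exists q, ratr q \in `]s, (s + e)[ by
  apply: rat_in_itvoo; rewrite ltrDl.
exists (U' `*` II (q1, q2)) => /=.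
  split; first by exists (U', (q1, q2)).
  by split => //=; rewrite /II /= in_itv /= q1s q2s.
move=> [a x] [/= U'a]; rewrite /II /= in_itv /= => /andP[x1 x2].
apply: UVW; split => /=; first exact: U'U.
apply: eV; rewrite /ball /= ltr_distlC.
have -> : s - e < x by apply: lt_trans x1; rewrite q1s.
by apply: (lt_trans x2); rewrite q2s.
Qed.

Lemma open_preimage_lsub (A : set 'rV[R]_m) : open A ->
  open [set z : 'rV[R]_(m + 1) | A (lsubmx z)].
Proof. by move=> oA; apply: open_comp => // z _; exact: lsubmx_continuous. Qed.

Lemma dom_coverL (x : carrierL) : exists c, domL c x.
Proof. by have [c] := dom_cover x.1; exists c. Qed.

Lemma open_domL c : open (domL c).
Proof.
apply: (@open_comp _ _ fst) => [x _|]; first exact: cvg_fst.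
exact: open_dom.
Qed.

Lemma open_codomL c : open (coordL c @` domL c).
Proof. by rewrite codomLE; apply/open_preimage_lsub/open_codom. Qed.

Lemma coordLK c x : domL c x -> paramL c (coordL c x) = x.
Proof.
by case: x => p s /= dp; rewrite /paramL /coordL row_mxKl row_mxEr mxE /= coordK.
Qed.

Lemma coordL_continuous c x : domL c x -> {for x, continuous (coordL c)}.
Proof.
case: x => p s dp; apply/cvgrPdist_lt => e e0.
have H1 : \forall y \near (p, s), `|chart_map c p - chart_map c y.1| < e.
  have /cvgrPdist_lt /(_ e e0) := continuous_coord dp.
  exact: cvg_fst.
have H2 : \forall y \near (p, s), `|s - y.2| < e.
  have /cvgrPdist_lt /(_ e e0) := (@cvg_id _ (nbhs s)).
  exact: (@cvg_snd _ _ (nbhs p) (nbhs s)).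
near=> y.
have : `|chart_map c p - chart_map c y.1| < e by near: y.
have : `|s - y.2| < e by near: y.
move=> h2; rewrite /Num.norm /= !mx_normrE => /bigmax_ltP[_ h1].
apply/bigmax_ltP; split => // -[a b] _ /=; rewrite !mxE.
case: splitP => j _; last by rewrite !mxE.
by have := h1 (a, j) isT; rewrite !mxE.
Unshelve. all: by end_near. Qed.

Lemma paramL_continuous c y : (coordL c @` domL c) y ->
  {for y, continuous (paramL c)}.
Proof.
rewrite codomLE => /= dy.
have C1 : {for y, continuous (chart_inv c \o lsubmx : 'rV[R]_(m + 1) -> P)}.
  apply: continuous_comp; first exact: lsubmx_continuous.
  exact: continuous_param.
have C2 : {for y, continuous (fun z : 'rV[R]_(m + 1) => z 0 (rshift m ord0))}.
  exact: coord_continuous.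
exact: (cvg_pair C1 C2).
Qed.

Lemma transitionL c d : coordL d \o paramL c =
  (fun z => row_mx ((chart_map d \o chart_inv c) (lsubmx z)) (rsubmx z)).
Proof.
apply/funext => z; rewrite /coordL /paramL /=; congr row_mx.
by apply/rowP => j; rewrite !mxE !ord1.
Qed.

Lemma smooth_transitionL c d a :
  smooth (coordL c @` (domL c `&` domL d))
         (fun y => coordL d (paramL c y) 0 a).
Proof.
have sub : coordL c @` (domL c `&` domL d) `<=`
    [set z | (chart_map c @` (chart_dom c `&` chart_dom d)) (lsubmx z)].
  by move=> _ [[x s] /= dx <-]; rewrite row_mxKl; exists x.
move=> k; apply: (Ck_sub sub).
apply: (@Ck_eq _ _ _ _ _
  (fun z => row_mx ((chart_map d \o chart_inv c) (lsubmx z)) (rsubmx z) 0 a)) => [z|].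
  exact: (congr1 (fun F : 'rV[R]_(m + 1) -> 'rV[R]_(m + 1) => F z 0 a)
    (transitionL c d)).
rewrite -[a]splitK; case: (fintype.split a) => j /=.
  apply: (@Ck_eq _ _ _ _ _ ((fun y => chart_map d (chart_inv c y) 0 j) \o lsubmx)).
    by move=> z; rewrite row_mxEl.
  apply: (@Ck_lsubmx _ _ 1 k (chart_map c @` (chart_dom c `&` chart_dom d))).
  exact: smooth_transition.
apply: (@Ck_eq _ _ _ _ _ (fun z => z 0 (rshift m j))); last exact: smooth_coord.
by move=> z; rewrite row_mxEr mxE.
Qed.

Lemma smooth_metricL c i j :
  smooth (coordL c @` domL c) (fun y => metricL c y i j).
Proof.
rewrite codomLE => k; rewrite -[i]splitK -[j]splitK.
case: (fintype.split i) => a; case: (fintype.split j) => b /=.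
- apply: (@Ck_eq _ _ _ _ _ ((fun y => chart_metric c y a b) \o lsubmx)).
    by move=> z; rewrite /metricL block_mxEul.
  apply: (@Ck_lsubmx _ _ 1 k (chart_map c @` chart_dom c)); exact: smooth_metric.
- apply: (@Ck_eq _ _ _ _ _ (fun=> 0)); last exact: Ck_cst.
  by move=> z; rewrite /metricL block_mxEur mxE.
- apply: (@Ck_eq _ _ _ _ _ (fun=> 0)); last exact: Ck_cst.
  by move=> z; rewrite /metricL block_mxEdl mxE.
- apply: (@Ck_eq _ _ _ _ _ (fun=> (1%:M : 'M[R]_1) a b)); last exact: Ck_cst.
  by move=> z; rewrite /metricL block_mxEdr.
Qed.

Lemma metric_symL c y : (coordL c @` domL c) y -> (metricL c y)^T = metricL c y.
Proof.
by rewrite codomLE => dy; rewrite /metricL tr_block_mx !trmx0 trmx1 metric_sym.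
Qed.

Lemma metric_posL c y : (coordL c @` domL c) y ->
  forall v : 'rV[R]_(m + 1), v != 0 -> 0 < (v *m metricL c y *m v^T) 0 0.
Proof.
rewrite codomLE => dy v; rewrite -[v]hsubmxK /metricL.
rewrite mul_row_block !mulmx0 addr0 add0r mulmx1 tr_row_mx mul_row_col.
set p := lsubmx v; set q := rsubmx v => v0.
have Eq : (q *m q^T) 0 0 = q 0 0 ^+ 2.
  by rewrite mxE big_ord1 [q^T _ _]mxE expr2 !ord1.
rewrite mxE Eq; have [p0|p0] := eqVneq p 0.
  rewrite p0 !mul0mx mxE add0r lt_neqAle sqr_ge0 andbT eq_sym sqrf_eq0.
  apply: contra v0 => /eqP q0; rewrite p0 (_ : q = 0) ?row_mx0 //.
  by apply/rowP => j; rewrite !ord1 q0 mxE.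
by rewrite ltr_pwDl ?sqr_ge0 // metric_pos.
Qed.

Lemma metric_changeL c d x : domL c x -> domL d x ->
  metricL c (coordL c x) =
    jac (coordL d \o paramL c) (coordL c x) *m metricL d (coordL d x)
      *m (jac (coordL d \o paramL c) (coordL c x))^T.
Proof.
case: x => p s /= cp dp; rewrite transitionL jac_row_mx /metricL /coordL /=.
rewrite !row_mxKl tr_block_mx !mulmx_block !(trmx0, trmx1, mul0mx, mulmx0).
by rewrite !(addr0, add0r, mulmx1, mul0mx) -metric_change.
Qed.

(* The Riemannian product (P x R, g_P + ds^2). *)
Definition prodLine : riemannianManifold R (m + 1) :=
  RiemannianManifold hausdorffL second_countableL dom_coverL open_domL
    open_codomL coordLK coordL_continuous paramL_continuous smooth_transitionL
    smooth_metricL metric_symL metric_posL metric_changeL.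

End ProductWithLine.

(* Submanifold geometry in coordinates: g is the matrix of a semi-Riemannian
   metric on (an open subset of) R^k and F is an immersion of (an open subset
   of) R^m into it. *)
Section Submanifold.
Context {R : realType} {m k : nat}.
Variables (g : 'rV[R]_k -> 'M[R]_k) (F : 'rV[R]_m -> 'rV[R]_k).

(* [christoffel p a b l] is Gamma^l_{ab}(p) of the Levi-Civita connection. *)
Definition christoffel (p : 'rV[R]_k) (a b l : 'I_k) : R :=
  2^-1 * \sum_d invmx (g p) l d *
    (pd a (fun q => g q b d) p + pd b (fun q => g q a d) p
     - pd d (fun q => g q a b) p).

Definition pullback (y : 'rV[R]_m) : 'M[R]_m :=
  jac F y *m g (F y) *m (jac F y)^T.

(* nabla_{F_* v} W at y, for W a vector field along F. *)
Definition covariant (v : 'rV[R]_m) (W : 'rV[R]_m -> 'rV[R]_k)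
    (y : 'rV[R]_m) : 'rV[R]_k :=
  v *m jac W y +
  \row_l \sum_a \sum_b
    christoffel (F y) a b l * (v *m jac F y) 0 a * W y 0 b.

(* The g-orthogonal projection of v onto the normal space of F at y. *)
Definition normal_part (y : 'rV[R]_m) (v : 'rV[R]_k) : 'rV[R]_k :=
  xget 0 [set w | (v - w <= jac F y)%MS /\
                  w *m g (F y) *m (jac F y)^T = 0].

(* The rows of E form a C^1 orthonormal frame for F^* g on D. *)
Definition orthonormal_frame (D : set 'rV[R]_m)
    (E : 'rV[R]_m -> 'M[R]_m) (eps : 'rV[R]_m) : Prop :=
  [/\ forall i, eps 0 i = 1 \/ eps 0 i = -1,
      forall i j, Ck 1 D (fun y => E y i j) &
      forall y, D y -> E y *m pullback y *m (E y)^T = diag_mx eps].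

Definition frame_mean_curvature (E : 'rV[R]_m -> 'M[R]_m) (eps : 'rV[R]_m)
    (y : 'rV[R]_m) : 'rV[R]_k :=
  \sum_i eps 0 i *:
    normal_part y (covariant (row i (E y)) (fun z => row i (E z) *m jac F z) y).

(* The sum is independent of the local orthonormal frame. *)
Definition is_mean_curvature (y : 'rV[R]_m) (H : 'rV[R]_k) : Prop :=
  exists D E eps, [/\ open D, D y, orthonormal_frame D E eps &
                      H = frame_mean_curvature E eps y].

End Submanifold.

Section RobertsonWalker.
Context {R : realType} {n : nat} (N : riemannianManifold R n).
Variables (I : set R) (b : R -> R).

(* The metric b(t)^2 g_N - dt^2 of N x I in the chart phi_c x id. *)
Definition grw_metric (c : chart N) (p : 'rV[R]_(n + 1)) : 'M[R]_(n + 1) :=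
  block_mx (b (p 0 (rshift n ord0)) ^+ 2 *: chart_metric c (lsubmx p)) 0
           0 (- 1%:M).

Definition partial_t : 'rV[R]_(n + 1) := row_mx 0 (const_mx 1).

(* x |-> (x, u x) in the charts phi_c and phi_c x id. *)
Definition graph_map (c : chart N) (u : N -> R) (y : 'rV[R]_n) :
    'rV[R]_(n + 1) :=
  row_mx y (const_mx (u (chart_inv c y))).

(* (x, s) |-> (x, A s t), for (s, t) in D, is the flow of b(t) partial_t. *)
Definition is_flow (D : set (R * R)) (A : R -> R -> R) : Prop :=
  [/\ open D, forall s, I s -> D (s, 0) /\ A s 0 = s,
      forall s, is_interval [set t | D (s, t)] &
      forall s t, D (s, t) ->
        [/\ I s, I (A s t) & is_derive t 1 (A s) (b (A s t))]].

Definition C2_on (Omega : set N) (u : N -> R) : Prop :=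
  forall c, Ck 2 (chart_map c @` (Omega `&` chart_dom c)) (u \o chart_inv c).

Definition nondegenerate_graph (Omega : set N) (u : N -> R) : Prop :=
  forall c x, Omega x -> chart_dom c x ->
    pullback (grw_metric c) (graph_map c u) (chart_map c x) \in unitmx.

(* The graph of u over Omega is an X-soliton for X = b(t) partial_t. *)
Definition Xsoliton (Omega : set N) (u : N -> R) : Prop :=
  [/\ open Omega, forall x, Omega x -> I (u x), C2_on Omega u,
      nondegenerate_graph Omega u &
      exists D A, is_flow D A /\
        forall x, Omega x -> \forall t \near (0 : R),
          forall c, chart_dom c x ->
            let u_t z := A (u z) t in
            is_mean_curvature (grw_metric c) (graph_map c u_t) (chart_map c x)
              (b (u_t x) *:
                 normal_part (grw_metric c) (graph_map c u_t) (chart_map c x)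
                   partial_t)].

End RobertsonWalker.

Arguments Xsoliton {R n} N I b Omega u.

Inductive warp := II | III.

Section Warps.
Context {R : realType}.
Implicit Types (c t : R) (n : nat).

Definition tanh t : R := (expR t - expR (- t)) / (expR t + expR (- t)).

Definition warp_dom (w : warp) c : set R :=
  match w with
  | II => `]0, (pi / (2 * c))[%classic
  | III => `]-oo, 0[%classic
  end.

Definition warp_fun (w : warp) n c t : R :=
  match w with
  | II => n%:R * c * tan (c * t)
  | III => - (n%:R * c * tanh (c * t))
  end.

Definition warp_cst (w : warp) n c : R :=
  match w with
  | II => - (c ^+ 2 * n%:R ^+ 2)
  | III => c ^+ 2 * n%:R ^+ 2
  end.

Lemma is_derive_tanh t : is_derive t 1 tanh (1 - tanh t ^+ 2).
Proof.
have p0 x : expR x + expR (- x) != 0 :> R.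
  by rewrite gt_eqF // addr_gt0 ?expR_gt0.
have D1 : is_derive t 1 (fun x : R => expR (- x)) (expR (- t) * -1).
  exact: (is_derive1_comp (is_derive_expR (- t)) (is_deriveN (is_derive_id t 1))).
have D2 : is_derive t 1 (fun x : R => expR x - expR (- x)) _ :=
  is_deriveB (is_derive_expR t) D1.
have D3 : is_derive t 1 (fun x : R => expR x + expR (- x)) _ :=
  is_deriveD (is_derive_expR t) D1.
have D4 : is_derive t 1 tanh _ := is_deriveM D2
  (@is_deriveV R (fun x => expR x + expR (- x)) t _ 1 (p0 t) D3).
apply: (is_derive_eq D4).
rewrite /tanh /= /GRing.scale /=; have := p0 t.
rewrite ?fctE; move: (expR t) (expR (- t)) => x y xy; field.
by move: xy; rewrite addrC.
Qed.

Lemma warp_cstE w n c t : 0 < c -> warp_dom w c t ->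
  warp_fun w n c t ^+ 2 - n%:R * derive1 (warp_fun w n c) t = warp_cst w n c.
Proof.
move=> c0.
have Dc : is_derive t 1 (fun x : R => c * x) c.
  by have := is_deriveZ c (is_derive_id t 1); rewrite /GRing.scale /= mulr1.
case: w => /=; rewrite in_itv /=.
  move=> /andP[t0 t1]; have ct : cos (c * t) != 0.
    rewrite gt_eqF // cos_gt0_pihalf //.
    have -> /= : - (pi / 2) < c * t.
      by rewrite (@lt_trans _ _ 0) ?mulr_gt0 // oppr_lt0 divr_gt0 ?pi_gt0.
    by rewrite mulrC -ltr_pdivlMr // -mulrA -invfM.
  have D := is_deriveZ (n%:R * c) (is_derive1_comp (is_derive_tan ct) Dc).
  have -> : derive1 (warp_fun II n c) t = n%:R * c * ((cos (c * t)) ^- 2 * c).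
    by rewrite derive1E; apply: derive_val.
  by rewrite cos2_tan2 //; ring.
move=> t0.
have D := is_deriveN (is_deriveZ (n%:R * c)
  (is_derive1_comp (is_derive_tanh (c * t)) Dc)).
have -> : derive1 (warp_fun III n c) t
    = - (n%:R * c * ((1 - tanh (c * t) ^+ 2) * c)).
  by rewrite derive1E; apply: derive_val.
by ring.
Qed.

End Warps.

Section Profiles.
Context {R : realType}.
Variables (w : warp) (n : nat) (c : R).
Let b := warp_fun w n c.
Implicit Types (L : set R) (f : R -> R).

Definition profile_solution L f : Prop :=
  [/\ open L, is_interval L, L !=set0 &
      forall s, L s ->
        [/\ warp_dom w c (f s), derivable f s 1, derivable (derive1 f) s 1 &
            derive1 (derive1 f) s =
              (1 - derive1 f s ^+ 2 / b (f s) ^+ 2) * b (f s) * warp_cst w n c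
              + derive1 b (f s) / b (f s) * derive1 f s ^+ 2]].

(* (L, f) is a non-extendable solution which extends (L', f'). *)
Definition maximal_extension (L' : set R) (f' : R -> R) L f : Prop :=
  [/\ profile_solution L f, L' `<=` L, forall s, L' s -> f s = f' s &
      forall M h, profile_solution M h -> L `<=` M ->
        (forall s, L s -> h s = f s) ->
        M = L].

Definition timelike L f : Prop :=
  forall s, L s -> 1 - derive1 f s ^+ 2 / b (f s) ^+ 2 < 0.

Definition spacelike L f : Prop :=
  forall s, L s -> 0 < 1 - derive1 f s ^+ 2 / b (f s) ^+ 2.

(* L is a half-line with finite end k; f blows up to l at k and tends to 0 at
   the infinite end. *)
Definition half_line_blow_up (l : set_system R) L f : Prop :=
  exists k : R,
    (f s @[s --> within L (nbhs k)] --> l) /\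
    ((L = `]-oo, k[%classic /\ f s @[s --> -oo] --> (0 : R)) \/
     (L = `]k, +oo[%classic /\ f s @[s --> +oo] --> (0 : R))).

Definition entire_vanishing L f : Prop :=
  [/\ L = setT, f s @[s --> -oo] --> (0 : R) & f s @[s --> +oo] --> (0 : R)].

End Profiles.

Section Classification.
Context {R : realType}.
Variables (n : nat) (c : R).
Implicit Types (L : set R) (f : R -> R).

Definition type_IIA L f : Prop :=
  timelike II n c L f /\ half_line_blow_up (nbhs (pi / (2 * c))) L f.

Definition type_IIB L f : Prop :=
  [/\ spacelike II n c L f, entire_vanishing L f &
      exists s0, forall s, f s <= f s0].

Definition type_IIC L f : Prop :=
  spacelike II n c L f /\ half_line_blow_up (nbhs (pi / (2 * c))) L f.

Definition type_IIIA L f : Prop :=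
  timelike III n c L f /\ half_line_blow_up (-oo) L f.

Definition type_IIIB L f : Prop :=
  [/\ spacelike III n c L f, entire_vanishing L f &
      exists s0, forall s, f s0 <= f s].

Definition in_exactly_one_class (w : warp) L f : Prop :=
  match w with
  | II => [\/ type_IIA L f, type_IIB L f | type_IIC L f] /\
          [/\ ~ (type_IIA L f /\ type_IIB L f),
              ~ (type_IIA L f /\ type_IIC L f) &
              ~ (type_IIB L f /\ type_IIC L f)]
  | III => (type_IIIA L f \/ type_IIIB L f) /\
           ~ (type_IIIA L f /\ type_IIIB L f)
  end.

End Classification.

(* Main.v *)
(* Projecting b d_t^perp = H on the normal direction of the graph of f turns the
   soliton equation at time 0 into the ODE for f.  Put v = f'/b(f), d = b^2 - n b'
   and a = n^2 c^2 = |d|; the ODE says v' = d (1 - v^2).  Let phi(t) be sin(ct) for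
   II and sinh(-ct) for III.  Since (log phi^-n)' = d/b, the function Y = phi(f)^-n
   satisfies Y' = d v Y, hence Y'' = a^2 Y, so that Y = al e^(as) + be e^(-as) and
   1 - v^2 = 4 al be / Y^2.  As phi^-n is a diffeomorphism from I onto ]y0, +oo[,
   with y0 = 1 for II and y0 = 0 for III, solutions of the ODE correspond to the
   intervals where al e^(as) + be e^(-as) > y0, maximal solutions to the connected
   components of this set, and the sign of al be <> 0 is the causal type.  The
   components are found by solving a quadratic equation in e^(as). *)
Require Import Defs.
From HB Require Import structures.
From mathcomp Require Import all_boot all_order all_algebra.
From mathcomp Require Import all_classical all_reals all_analysis.
From mathcomp Require Import ring lra.

Set Implicit Arguments.
Unset Strict Implicit.
Unset Printing Implicit Defensive.

Import Order.TTheory GRing.Theory Num.Theory.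
Import numFieldNormedType.Exports.

Local Open Scope classical_set_scope.
Local Open Scope ring_scope.

(** * Mean curvature of the graph of a profile *)

(** The soliton hypothesis supplies an unspecified orthonormal frame. Paired with the conormal of
    the graph, its vectors enter only through two sums that orthonormality evaluates, so every frame
    yields the same scalar equation. The equation v' = d (1 - v^2) is of Riccati type, and Y is the
    function that linearises it: Y' = d v Y turns v' + d v^2 = d into Y'' = d^2 Y. Both signs of d
    thus give one linear equation, and II and III differ only through phi. Maximality is decided by
    coefficients: the values of Y on a nonempty open set determine (al, be), so an extension keeps
    the pair and cannot pass an endpoint of a component, where the combination equals y0. A bounded
    component would require al < 0 and be < 0, against Y > 0; hence only the line and half-lines
    occur. For III, y0 = 0 and a combination with al be > 0 has no zero, which is why that case has
    no spacelike half-line class. *)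

Section DirectionalDerivative.
Context {R : realType} {m : nat}.
Implicit Types (F : 'rV[R]_m -> R) (h : R -> R) (z v : 'rV[R]_m).

Lemma derive_along F h z v : (forall t : R, F (t *: v + z) = h t) ->
  'D_v F z = 'D_1 h 0.
Proof.
move=> Fh; have E : (fun t : R => t^-1 *: ((F \o shift z) (t *: v) - F z)) =
    (fun t : R => t^-1 *: ((h \o shift 0) (t *: (1 : R)) - h 0)); last by rewrite /derive E.
apply/funext => t /=.
by rewrite Fh -[in F z](add0r z) -(scale0r v) Fh addr0 /GRing.scale /= mulr1.
Qed.

Lemma derive_along_cst F z v : (forall t : R, F (t *: v + z) = F z) -> 'D_v F z = 0.
Proof. by move=> Fz; rewrite (@derive_along _ (fun=> F z)) // derive_cst. Qed.

Lemma derive_coord_comp h (a : 'I_m) z v :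
  (derivable h (z 0 a) (v 0 a) <-> derivable (fun y : 'rV[R]_m => h (y 0 a)) z v) /\
  'D_v (fun y : 'rV[R]_m => h (y 0 a)) z = 'D_(v 0 a) h (z 0 a).
Proof.
have E : (fun t : R => t^-1 *: (((fun y : 'rV[R]_m => h (y 0 a)) \o shift z) (t *: v)
             - h (z 0 a))) =
  (fun t : R => t^-1 *: ((h \o shift (z 0 a)) (t *: v 0 a) - h (z 0 a))).
  by apply/funext => t /=; rewrite !mxE.
by rewrite /derivable /derive E.
Qed.

Lemma pd_coord_comp h (a i : 'I_m) z :
  pd i (fun y : 'rV[R]_m => h (y 0 a)) z = derive1 h (z 0 a) *+ (i == a).
Proof.
rewrite /pd (derive_coord_comp h a z _).2 mxE eqxx /= derive1E [i == a]eq_sym.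
by case: (a == i); rewrite ?mulr1n ?mulr0n ?derive0.
Qed.

End DirectionalDerivative.

Section NormalPart.
Context {R : realType} {m : nat}.
Variables (g : 'rV[R]_(m + 1) -> 'M[R]_(m + 1)) (F : 'rV[R]_m -> 'rV[R]_(m + 1)).
Variables (y : 'rV[R]_m) (q : 'cV[R]_m) (nu : 'rV[R]_(m + 1)).
Let N : 'cV[R]_(m + 1) := col_mx q (- 1%:M).
Hypotheses (jacF : jac F y = row_mx 1%:M q) (nuE : nu *m g (F y) = N^T)
  (nu_neq0 : (nu *m N) 0 0 != 0).

(* The column N is a covector annihilating the tangent space, so it only sees the
   normal part; only the existence of the decomposition has to be checked. *)
Lemma normal_part_conormal v : normal_part g F y v *m N = v *m N.
Proof.
have JN : jac F y *m N = 0 by rewrite jacF mul_row_col mul1mx mulmxN mulmx1 subrr.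
have tangent (u : 'rV[R]_(m + 1)) : u *m N = 0 -> (u <= jac F y)%MS.
  move=> uN; apply/submxP; exists (lsubmx u); rewrite jacF mul_mx_row mulmx1.
  rewrite -[LHS]hsubmxK; congr row_mx; move: uN.
  rewrite -[u in u *m N]hsubmxK mul_row_col mulmxN mulmx1 => /eqP.
  by rewrite subr_eq0 => /eqP.
(* [nu] is the metric dual of [N], hence normal; [l] is the coefficient for which [v - l *: nu] is
   annihilated by [N], that is, tangent. *)
pose l := (v *m N) 0 0 / (nu *m N) 0 0.
have ex : exists w, (v - w <= jac F y)%MS /\ w *m g (F y) *m (jac F y)^T = 0.
  exists (l *: nu); split.
    apply: tangent; rewrite mulmxBl -scalemxAl.
    apply/matrixP => i j; rewrite !ord1 mxE [X in _ + X]mxE [X in - X]mxE [RHS]mxE.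
    by rewrite /l divfK // subrr.
  by rewrite -scalemxAl nuE -scalemxAl -trmx_mul JN trmx0 scaler0.
have [/submxP[D vw] _] := xgetPex 0 ex.
apply/eqP; rewrite eq_sym -subr_eq0 -mulmxBl /normal_part.
by rewrite [v - _]vw -mulmxA JN mulmx0.
Qed.

End NormalPart.

(** * The graph in a chart: conormal, induced metric, contracted Christoffel symbols *)

Section GraphCurvature.
Context {R : realType} {m : nat} (P : riemannianManifold R m).
Variables (ch : chart P) (b f : R -> R).
Implicit Types p : 'rV[R]_(m + 1 + 1).

Let si : 'I_(m + 1) := rshift m ord0.
Let ti : 'I_(m + 1 + 1) := rshift (m + 1) ord0.
Let g : 'rV[R]_(m + 1 + 1) -> 'M[R]_(m + 1 + 1) := @grw_metric R (m + 1) (prodLine P) b ch.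
Let F : 'rV[R]_(m + 1) -> 'rV[R]_(m + 1 + 1) :=
  @graph_map R (m + 1) (prodLine P) ch (fun x => f x.2).
Let K (p : 'rV[R]_(m + 1 + 1)) : 'M[R]_(m + 1) := metricL ch (lsubmx p).

Lemma grw_metric_ll p j k : g p (lshift 1 j) (lshift 1 k) = b (p 0 ti) ^+ 2 * K p j k.
Proof. by rewrite /g /grw_metric block_mxEul mxE. Qed.

Lemma grw_metric_rE p k : g p ti k = - (k == ti)%:R.
Proof.
rewrite /g /grw_metric -[k]splitK; case: (fintype.split k) => j /=.
  by rewrite block_mxEdl mxE eq_lrshift oppr0.
by rewrite !ord1 block_mxEdr !mxE !eqxx.
Qed.

Lemma grw_metric_lrE p k : g p k ti = - (k == ti)%:R.
Proof.
rewrite /g /grw_metric -[k]splitK; case: (fintype.split k) => j /=.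
  by rewrite block_mxEur mxE eq_lrshift oppr0.
by rewrite !ord1 block_mxEdr !mxE !eqxx.
Qed.

Lemma metricL_si z j : metricL ch z j si = (j == si)%:R.
Proof.
rewrite /metricL -[j]splitK; case: (fintype.split j) => k /=.
  by rewrite block_mxEur mxE eq_lrshift.
by rewrite !ord1 block_mxEdr !mxE !eqxx.
Qed.

Lemma grw_metric_lsi p k : g p k (lshift 1 si) = b (p 0 ti) ^+ 2 * (k == lshift 1 si)%:R.
Proof.
rewrite -[k]splitK; case: (fintype.split k) => j /=.
  by rewrite grw_metric_ll /K metricL_si eq_lshift.
by rewrite !ord1 grw_metric_rE eq_lrshift eq_rlshift oppr0 mulr0.
Qed.

Lemma pd_grw_metric_ti p a k : pd a (fun q => g q k ti) p = 0.
Proof.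
by apply: derive_along_cst => t; rewrite !grw_metric_lrE.
Qed.

Lemma pd_si_grw_metric p a k : pd (lshift 1 si) (fun q => g q a k) p = 0.
Proof.
apply: derive_along_cst => t; congr (_ a k); rewrite /g /grw_metric.
have -> : (t *: delta_mx 0 (lshift 1 si) + p) 0 (rshift (m + 1) ord0) =
          p 0 (rshift (m + 1) ord0).
  by rewrite !mxE eq_rlshift andbF mulr0 add0r.
congr (block_mx (_ *: _) _ _ _); rewrite /= /metricL.
congr (block_mx (chart_metric _ _) _ _ _).
by apply/rowP => j; rewrite !mxE eq_lshift eq_lrshift andbF mulr0 add0r.
Qed.

Lemma derive_sqr_compMr (t k : R) : derivable b t 1 ->
  'D_1 (fun h : R => b (h + t) ^+ 2 * k) 0 = 2 * b t * derive1 b t * k.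
Proof.
move=> db; pose h0 (h : R) := h + t.
have D0 : is_derive (0 : R) 1 h0 1.
  by have := is_deriveD (is_derive_id (0 : R) 1) (is_derive_cst t (0 : R) 1); rewrite addr0.
have Db : is_derive (h0 0) 1 b (derive1 b t).
  by rewrite /h0 add0r derive1E; apply/derivableP.
have D1 := is_derive1_comp Db D0.
have D2 : is_derive (0 : R) 1 (fun h : R => b (h + t) ^+ 2 * k) _ :=
  is_deriveM (is_deriveM D1 D1) (is_derive_cst k (0 : R) 1).
rewrite (@derive_val _ _ _ _ _ _ _ D2).
rewrite /GRing.scale /= /h0 add0r; ring.
Qed.

Lemma pd_ti_grw_metric p j k : derivable b (p 0 ti) 1 ->
  pd ti (fun q => g q (lshift 1 j) (lshift 1 k)) p =
  2 * b (p 0 ti) * derive1 b (p 0 ti) * K p j k.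
Proof.
move=> db; rewrite /pd -derive_sqr_compMr //; apply: derive_along => t.
have E1 : (t *: delta_mx 0 ti + p) 0 ti = t + p 0 ti by rewrite !mxE !eqxx mulr1.
have E2 : lsubmx (t *: delta_mx 0 ti + p) = lsubmx p.
  by apply/rowP => i; rewrite !mxE eq_lrshift andbF mulr0 add0r.
by rewrite grw_metric_ll /K E1 E2.
Qed.

Lemma pd_grw_metric_si p a k : derivable b (p 0 ti) 1 ->
  pd a (fun q => g q k (lshift 1 si)) p =
  2 * b (p 0 ti) * derive1 b (p 0 ti) * (a == ti)%:R * (k == lshift 1 si)%:R.
Proof.
move=> db; have [->|aN] := eqVneq a ti.
  rewrite /pd mulr1 -derive_sqr_compMr //; apply: derive_along => t.
  by rewrite grw_metric_lsi !mxE !eqxx mulr1.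
rewrite mulr0 mul0r; apply: derive_along_cst => t.
by rewrite !grw_metric_lsi !mxE eq_sym (negbTE aN) andbF mulr0 add0r.
Qed.

(** The differential of (p, s) |-> f s, a column because a Jacobian has one row per partial
    derivative. *)
Definition slope_covector (z : 'rV[R]_(m + 1)) : 'cV[R]_(m + 1) :=
  derive1 f (z 0 si) *: delta_mx si 0.
Local Notation q := slope_covector.

Lemma jac_graph z : jac F z = row_mx 1%:M (q z).
Proof.
apply/matrixP => i a; rewrite -[a]splitK; case: (fintype.split a) => j /=.
  rewrite row_mxEl !mxE /pd.
  have -> : (fun y => F y 0 (lshift 1 j)) = (fun y : 'rV[R]_(m + 1) => y 0 j).
    by apply/funext => y; rewrite /F /graph_map row_mxEl.
  by rewrite (derive_coord _ _ _).2 mxE eqxx eq_sym.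
rewrite row_mxEr !mxE !ord1 eqxx andbT mulr_natr -pd_coord_comp.
congr (pd _ _ _); apply/funext => y.
by rewrite /F /graph_map row_mxEr mxE.
Qed.

Lemma slope_covectorE z : q z = col_mx 0 (derive1 f (z 0 si))%:M.
Proof.
apply/matrixP => i j; rewrite -[i]splitK !ord1; case: (fintype.split i) => k /=.
  by rewrite col_mxEu !mxE eq_lrshift mulr0.
by rewrite col_mxEd !mxE !ord1 !eqxx mulr1.
Qed.

Lemma mulmx_slope k (A : 'M[R]_(k, m + 1)) z :
  A *m q z = derive1 f (z 0 si) *: col si A.
Proof. by rewrite /q -scalemxAr -colE. Qed.

Variable y : 'rV[R]_(m + 1).
Let s := y 0 si.
Let f1 := derive1 f s.
Let B := b (f s).
Let B1 := derive1 b (f s).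
Let Ky := metricL ch y.
Let N : 'cV[R]_(m + 1 + 1) := col_mx (q y) (- 1%:M).

(** The metric dual of the conormal [N]: the s direction is of unit length and orthogonal to P, so
    raising the index of [q] only divides it by [B ^+ 2], and the sign of -dt^2 turns -1 into 1. *)
Definition graph_normal : 'rV[R]_(m + 1 + 1) := row_mx (B ^- 2 *: (q y)^T) 1%:M.

Lemma graph_map_ti : F y 0 ti = f s.
Proof. by rewrite /F /graph_map row_mxEr mxE. Qed.

Lemma graph_map_lsubmx : lsubmx (F y) = y.
Proof. by rewrite /F /graph_map row_mxKl. Qed.

Lemma grw_metric_graph : g (F y) = block_mx (B ^+ 2 *: Ky) 0 0 (- 1%:M).
Proof.
rewrite /g /grw_metric -/ti graph_map_ti.
by rewrite graph_map_lsubmx.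
Qed.

Lemma tr_slope_metricL : (q y)^T *m Ky = (q y)^T.
Proof.
rewrite slope_covectorE tr_col_mx trmx0 tr_scalar_mx /Ky /metricL mul_row_block.
by rewrite !mul0mx !mulmx0 !add0r mulmx1.
Qed.

Lemma tr_slope_slope : ((q y)^T *m q y) 0 0 = f1 ^+ 2.
Proof. by rewrite mulmx_slope !mxE !eqxx mulr1 expr2. Qed.

Lemma graph_normal_metric : B != 0 -> graph_normal *m g (F y) = N^T.
Proof.
move=> B0; rewrite grw_metric_graph /graph_normal mul_row_block !mulmx0 addr0 add0r.
rewrite -scalemxAl -scalemxAr tr_slope_metricL scalerA mulVf ?expf_neq0 // scale1r.
by rewrite mul1mx /N tr_col_mx [(- _)^T]linearN /= trmx1.
Qed.

Lemma graph_normal_conormal : (graph_normal *m N) 0 0 = f1 ^+ 2 / B ^+ 2 - 1.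
Proof.
rewrite /graph_normal /N mul_row_col mulmxN mulmx1 -scalemxAl mxE [X in X + _]mxE.
by rewrite tr_slope_slope [X in _ + X]mxE [X in - X]mxE eqxx mulrC.
Qed.

Lemma pullback_graph : pullback g F y = B ^+ 2 *: Ky - q y *m (q y)^T.
Proof.
rewrite /pullback jac_graph grw_metric_graph mul_row_block !mulmx0 addr0 add0r.
by rewrite tr_row_mx mul_row_col trmx1 !mulmx1 mul1mx mulmxN mulmx1 mulNmx.
Qed.

(** The s direction is an eigenvector of the induced metric. Nondegeneracy therefore excludes
    [f1 ^+ 2 = B ^+ 2], and the inverse metric is known in this direction whatever g_P is. *)
Lemma delta_pullback_graph :
  delta_mx 0 si *m pullback g F y = (B ^+ 2 - f1 ^+ 2) *: (delta_mx 0 si : 'rV_(m + 1)).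
Proof.
rewrite pullback_graph mulmxBr -scalemxAr -!rowE scalerBl; congr (_ *: _ - _).
  apply/rowP => j; rewrite /Ky [LHS]mxE [RHS]mxE eqxx /=.
  rewrite /metricL /si -[j]splitK; case: (fintype.split j) => k /=.
    by rewrite block_mxEdl mxE eq_lrshift.
  by rewrite block_mxEdr !mxE !ord1 !eqxx.
rewrite row_mul; apply/rowP => j; rewrite !mxE big_ord1 !mxE !eqxx mulr1 andbT.
by rewrite -/s -/f1 expr2 mulrA.
Qed.

Lemma unitmx_metricL : (coordL ch @` domL ch) y -> Ky \in unitmx.
Proof.
move=> dy; rewrite -row_free_unit -kermx_eq0; apply/eqP/row_matrixP => i.
rewrite row0; apply/eqP; apply: contraT => v0.
have := metric_posL dy v0; rewrite -/Ky -row_mul mulmx_ker row0 mul0mx mxE ltxx //.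
Qed.

Lemma unitmx_grw_metric : (coordL ch @` domL ch) y -> B != 0 -> g (F y) \in unitmx.
Proof.
move=> dy B0; rewrite grw_metric_graph unitmxE det_ublock unitrM detZ unitrM.
rewrite -!unitmxE unitmx_metricL // andbT unitfE expf_neq0 ?expf_neq0 //=.
by rewrite -scaleN1r unitmxE detZ det1 mulr1 unitrX // unitrN1.
Qed.

(** Contracting the upper index with [N] absorbs the inverse metric, since [N^T] times it is
    [graph_normal]. That vector has only s and t components, and the metric does not depend on s, so
    no derivative of g_P survives: what remains comes from the t-derivative of the warping
    factor. *)
Lemma christoffel_conormal a k :
    (coordL ch @` domL ch) y -> derivable b (f s) 1 -> B != 0 ->
  \sum_l christoffel g (F y) a k l * N l 0 =
  B * B1 * (f1 / (B ^+ 2) * ((a == ti)%:R * (k == lshift 1 si)%:R +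
                             (k == ti)%:R * (a == lshift 1 si)%:R)
              - (block_mx Ky 0 0 0 : 'M[R]_(m + 1 + 1)) a k).
Proof.
move=> dy db B0.
pose Y d := pd a (fun z => g z k d) (F y) + pd k (fun z => g z a d) (F y)
     - pd d (fun z => g z a k) (F y).
have nuE : N^T *m invmx (g (F y)) = graph_normal.
  by rewrite -graph_normal_metric // mulmxK // unitmx_grw_metric.
have db' : derivable b (F y 0 ti) 1 by rewrite graph_map_ti.
transitivity (2^-1 * \sum_d graph_normal 0 d * Y d).
  rewrite -nuE /christoffel mulr_sumr.
  under eq_bigr => l _ do rewrite mulr_sumr mulr_suml.
  rewrite exchange_big /=; apply: eq_bigr => d _.
  rewrite mxE mulr_suml mulr_sumr; apply: eq_bigr => l _.
  by rewrite [N^T _ _]mxE -/(Y d); ring.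
have nuY : \sum_d graph_normal 0 d * Y d = f1 / B ^+ 2 * Y (lshift 1 si) + Y ti.
  rewrite big_split_ord /= big_ord1; congr (_ + _); last first.
    by rewrite /graph_normal row_mxEr mxE mul1r.
  rewrite (bigD1 si) //= big1 ?addr0 => [|j jN]; rewrite /graph_normal row_mxEl !mxE.
    by rewrite !eqxx mulr1 [_^-1 * _]mulrC.
  by rewrite (negbTE jN) !mulr0 mul0r.
rewrite nuY /Y pd_si_grw_metric !pd_grw_metric_si // !pd_grw_metric_ti !add0r subr0.
have -> : pd ti (fun z => g z a k) (F y) =
    2 * B * B1 * (block_mx Ky 0 0 0 : 'M[R]_(m + 1 + 1)) a k.
  rewrite -[a]splitK -[k]splitK.
  case: (fintype.split a) => a'; case: (fintype.split k) => k' /=.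
  - by rewrite pd_ti_grw_metric // graph_map_ti block_mxEul /K graph_map_lsubmx.
  - by rewrite !ord1 pd_grw_metric_ti block_mxEur mxE mulr0.
  - rewrite block_mxEdl mxE mulr0; apply: derive_along_cst => t.
    by rewrite !ord1 !grw_metric_rE.
  - by rewrite !ord1 pd_grw_metric_ti block_mxEdr mxE mulr0.
rewrite graph_map_ti -/B -/B1; field.
by [].
Qed.

End GraphCurvature.

Lemma mulmx_delta_tr (R : comNzRingType) (m : nat) (u : 'rV[R]_m) i j :
  (u *m delta_mx i j *m u^T) 0 0 = u 0 i * u 0 j.
Proof.
by rewrite -(mul_delta_mx (0 : 'I_1)) mulmxA -colE -mulmxA -rowE mxE big_ord1 !mxE.
Qed.

(** * Covariant derivative of a pushed-forward frame vector, paired with the conormal *)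

Section PushforwardConormal.
Context {R : realType} {m : nat} (P : riemannianManifold R m).
Variables (ch : chart P) (b f : R -> R) (y : 'rV[R]_(m + 1)).
Let si : 'I_(m + 1) := rshift m ord0.
Let ti : 'I_(m + 1 + 1) := rshift (m + 1) ord0.
Let g : 'rV[R]_(m + 1 + 1) -> 'M[R]_(m + 1 + 1) := @grw_metric R (m + 1) (prodLine P) b ch.
Let F : 'rV[R]_(m + 1) -> 'rV[R]_(m + 1 + 1) :=
  @graph_map R (m + 1) (prodLine P) ch (fun x => f x.2).
Let s := y 0 si.
Let f1 := derive1 f s.
Let B := b (f s).
Let B1 := derive1 b (f s).
Let Ky := metricL ch y.
Local Notation q := (slope_covector f).
Let N : 'cV[R]_(m + 1 + 1) := col_mx (q y) (- 1%:M).
Variables (E : 'rV[R]_(m + 1) -> 'M[R]_(m + 1)) (i : 'I_(m + 1)).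
Let W z : 'rV[R]_(m + 1 + 1) := row i (E z) *m jac F z.
Let e := row i (E y).
Let x := e *m jac F y.

Lemma graph_pushforward z :
  W z = row_mx (row i (E z)) (E z i si * derive1 f (z 0 si))%:M.
Proof.
rewrite /W jac_graph mul_mx_row mulmx1 mulmx_slope; congr row_mx.
by apply/matrixP => a k; rewrite !ord1 !mxE eqxx mulrC.
Qed.

(** [W] is tangent, so its product with the moving conormal vanishes identically; differentiating
    this product, the derivatives of the frame cancel and only the variation f'' of the conormal is
    left. *)
Lemma jac_pushforward_conormal :
    (forall k, derivable (fun z => E z i si) y (delta_mx 0 k)) ->
    derivable (derive1 f) s 1 ->
  (e *m jac W y *m N) 0 0 = - (E y i si ^+ 2 * derive1 (derive1 f) s).
Proof.
move=> dE df.
suff JW : jac W y *m N = (- (E y i si * derive1 (derive1 f) s)) *: delta_mx si 0.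
  by rewrite -mulmxA JW -scalemxAr -colE !mxE; ring.
apply/matrixP => k j; rewrite !ord1 mxE big_split_ord /= big_ord1.
have Wl j' : (fun z => W z 0 (lshift 1 j')) = (fun z => E z i j').
  by apply/funext => z; rewrite graph_pushforward row_mxEl mxE.
have Wt : (fun z => W z 0 (rshift (m + 1) ord0)) =
    (fun z => E z i si) * (fun z => derive1 f (z 0 si)).
  by apply/funext => z; rewrite graph_pushforward row_mxEr mxE eqxx.
under eq_bigr => j' _ do rewrite /N col_mxEu !mxE Wl.
rewrite (bigD1 si) //= big1 ?addr0 => [|j' /negbTE ->]; last by rewrite !mulr0.
rewrite /N col_mxEd !mxE !eqxx mulr1 mulrN mulr1 andbT /pd Wt.
have df' : derivable (fun z : 'rV[R]_(m + 1) => derive1 f (z 0 si)) y (delta_mx 0 k).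
  apply: (derive_coord_comp (derive1 f) si y (delta_mx 0 k)).1.1.
  have -> : (delta_mx 0 k : 'rV[R]_(m + 1)) 0 si = (si == k)%:R by rewrite mxE.
  by case: (si == k); [exact: df | exact: derivable0].
have pdf' : 'D_(delta_mx 0 k) (fun z : 'rV[R]_(m + 1) => derive1 f (z 0 si)) y =
    derive1 (derive1 f) s *+ (k == si) := pd_coord_comp _ _ _ _.
rewrite (deriveM (dE k) df') pdf' /GRing.scale /= -/s -/f1.
by rewrite -mulr_natr; ring.
Qed.

Lemma christoffel_pushforward_conormal :
    (coordL ch @` domL ch) y -> derivable b (f s) 1 -> B != 0 ->
  ((\row_l \sum_a \sum_k christoffel g (F y) a k l * x 0 a * W y 0 k) *m N) 0 0 =
  2 * (B1 / B) * f1 ^+ 2 * E y i si ^+ 2 - B * B1 * (e *m Ky *m e^T) 0 0.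
Proof.
move=> dy db B0.
(* After contraction with [N] the symbols form a bilinear form, evaluated twice at the
   pushed-forward vector [x]; its mixed s-t part gives the f'^2 term and its [Ky] part the trace
   term. *)
pose C : 'M[R]_(m + 1 + 1) := \matrix_(a, k) \sum_l christoffel g (F y) a k l * N l 0.
transitivity ((x *m C *m x^T) 0 0).
  rewrite [LHS]mxE [RHS]mxE.
  under eq_bigr => l _ do rewrite mxE mulr_suml.
  rewrite exchange_big /=; under [RHS]eq_bigr => k _ do rewrite mxE mulr_suml.
  rewrite [RHS]exchange_big /=; apply: eq_bigr => a _.
  under eq_bigr => l _ do rewrite mulr_suml.
  rewrite exchange_big /=; apply: eq_bigr => k _.
  rewrite [C _ _]mxE mulr_sumr mulr_suml; apply: eq_bigr => l _.
  by rewrite [x^T _ _]mxE /W -/e -/x; ring.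
have -> : C = (B * B1) *: ((f1 / B ^+ 2) *: (delta_mx ti (lshift 1 si) + delta_mx (lshift 1 si) ti)
     - block_mx Ky 0 0 0).
  apply/matrixP => a k; rewrite mxE christoffel_conormal //.
  move: (block_mx Ky 0 0 0 : 'M[R]_(m + 1 + 1)) => M; rewrite !mxE.
  by rewrite -!natrM !mulnb [(k == ti) && _]andbC.
have xE : x = row_mx e (E y i si * f1)%:M by exact: graph_pushforward.
have -> : forall A, x *m (B * B1 *: A) *m x^T = (B * B1) *: (x *m A *m x^T).
  by move=> A; rewrite -scalemxAr -scalemxAl.
rewrite mulmxBr mulmxBl -scalemxAr -scalemxAl mulmxDr mulmxDl.
have -> : x *m block_mx Ky 0 0 0 *m x^T = e *m Ky *m e^T.
  by rewrite xE mul_row_block tr_row_mx mul_row_col !mulmx0 !addr0 mul0mx addr0.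
have xs : x 0 (lshift 1 si) = E y i si by rewrite xE row_mxEl mxE.
have xt : x 0 ti = E y i si * f1 by rewrite xE row_mxEr mxE eqxx.
move: (e *m Ky *m e^T) => D; rewrite mxE [X in _ * X]mxE [X in _ * (X + _)]mxE.
rewrite [X in _ * (_ * X + _)]mxE !mulmx_delta_tr [X in _ * (_ + X)]mxE xs xt.
by field.
Qed.

End PushforwardConormal.

(** * The soliton condition at one point as a scalar equation *)

Section MeanCurvatureEquation.
Context {R : realType} {m : nat} (P : riemannianManifold R m).
Variables (ch : chart P) (b f : R -> R) (y : 'rV[R]_(m + 1)).
Let si : 'I_(m + 1) := rshift m ord0.
Let g : 'rV[R]_(m + 1 + 1) -> 'M[R]_(m + 1 + 1) := @grw_metric R (m + 1) (prodLine P) b ch.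
Let F : 'rV[R]_(m + 1) -> 'rV[R]_(m + 1 + 1) :=
  @graph_map R (m + 1) (prodLine P) ch (fun x => f x.2).
Let s := y 0 si.
Let f1 := derive1 f s.
Let B := b (f s).
Let B1 := derive1 b (f s).

Lemma graph_mean_curvature_eq :
    (coordL ch @` domL ch) y -> derivable (derive1 f) s 1 -> derivable b (f s) 1 ->
    0 < B -> pullback g F y \in unitmx ->
    is_mean_curvature g F y (B *: normal_part g F y (partial_t (n := m + 1))) ->
  f1 ^+ 2 != B ^+ 2 /\
  derive1 (derive1 f) s =
    (B ^+ 2 - f1 ^+ 2) * (B ^+ 2 - (m + 1)%:R * B1) / B + B1 / B * f1 ^+ 2.
Proof.
move=> dy df db B_gt0 hu [D [E [eps [oD Dy [epsE cE ortho] HE]]]].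
have B0 : B != 0 by rewrite gt_eqF.
(* Equality would put the s direction in the kernel of the invertible induced metric. *)
have fB : f1 ^+ 2 != B ^+ 2.
  apply/eqP => fB; have := delta_pullback_graph ch b f y.
  rewrite -/si -/s -/f1 -/B -/g -/F fB subrr scale0r.
  move=> /(congr1 (fun A => A *m invmx (pullback g F y))).
  rewrite mulmxK // mul0mx => /rowP/(_ si); rewrite !mxE !eqxx => /eqP.
  by rewrite oner_eq0.
split => //.
have dB0 : B ^+ 2 - f1 ^+ 2 != 0 by rewrite subr_eq0 eq_sym.
pose N : 'cV[R]_(m + 1 + 1) := col_mx (slope_covector f y) (- 1%:M).
have NP v : normal_part g F y v *m N = v *m N.
  apply: normal_part_conormal; first exact: jac_graph.
    exact: graph_normal_metric.
  rewrite graph_normal_conormal subr_eq0 -/s -/f1 -/B.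
  have B2 : B ^+ 2 != 0 by rewrite expf_neq0.
  by apply: contra fB => /eqP h; rewrite -(divfK B2 (f1 ^+ 2)) h mul1r.
have dE i k : derivable (fun z => E z i si) y (delta_mx 0 k).
  by have [_ /(_ k)[/(_ _ Dy)]] := cE i si.
pose K := metricL ch y.
pose S := \sum_i eps 0 i * E y i si ^+ 2.
have eps2 i : eps 0 i * eps 0 i = 1 by case: (epsE i) => ->; rewrite ?mulr1 ?mulrNN ?mulr1.
(* The soliton equation paired with [N]; the left side is [- B] because [N] takes the value -1 on
   [partial_t]. *)
have HN : - B = \sum_i eps 0 i * (- (E y i si ^+ 2 * derive1 (derive1 f) s) +
    (2 * (B1 / B) * f1 ^+ 2 * E y i si ^+ 2 -
     B * B1 * (row i (E y) *m K *m (row i (E y))^T) 0 0)).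
  have := congr1 (fun v => (v *m N) 0 0) HE; rewrite -scalemxAl NP mxE.
  have -> : (partial_t *m N) 0 0 = -1.
    by rewrite /N /partial_t mul_row_col mul0mx add0r mulmxN mulmx1 !mxE.
  rewrite mulrN1 => ->; rewrite /frame_mean_curvature mulmx_suml summxE.
  apply: eq_bigr => i _; rewrite -scalemxAl NP mxE; congr (_ * _).
  rewrite /covariant mulmxDl mxE; congr (_ + _).
    exact: jac_pushforward_conormal.
  exact: christoffel_pushforward_conormal.
(* The length of the i-th frame vector for [B ^+ 2 *: K - q *m q^T] is [eps 0 i]; solve for its
   [K]-length and multiply by [eps 0 i], whose square is 1. *)
have KE i : eps 0 i * (row i (E y) *m K *m (row i (E y))^T) 0 0 =
   (1 + f1 ^+ 2 * (eps 0 i * E y i si ^+ 2)) / B ^+ 2.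
  have : (row i (E y) *m pullback g F y *m (row i (E y))^T) 0 0 = eps 0 i.
    have := congr1 (fun A : 'M[R]_(m + 1) => A i i) (ortho _ Dy).
    rewrite [RHS]mxE eqxx mulr1n => <-.
    by rewrite -row_mul tr_row colE mulmxA -row_mul -colE [LHS]mxE [LHS]mxE.
  rewrite pullback_graph mulmxBr mulmxBl -scalemxAr -scalemxAl mulmxA.
  rewrite -mulmxA -trmx_mul mulmx_slope -/K -/si -/s -/f1 -/B mxE [X in X + _]mxE.
  rewrite [X in _ + X]mxE [X in - X]mxE big_ord1 !mxE.
  move: (\sum_j _) => D1 h.
  have -> : D1 = (eps 0 i + f1 * E y i si * (f1 * E y i si)) / B ^+ 2.
    by rewrite -h; field.
  by rewrite -(eps2 i); field.
(* The frame writes the inverse induced metric as E^T diag(eps) E, whose (s, s) entry is [S]; the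
   eigenvector relation says that this entry is the inverse of [B ^+ 2 - f1 ^+ 2]. *)
have SE : S * (B ^+ 2 - f1 ^+ 2) = 1.
  have DD : diag_mx eps *m diag_mx eps = 1%:M.
    rewrite mulmx_diag; apply/matrixP => i j; rewrite !mxE eps2.
    by case: (i == j).
  have := delta_pullback_graph ch b f y; rewrite -/si -/s -/f1 -/B -/g -/F.
  move: (ortho _ Dy); move: (pullback g F y) => h oh dh.
  have /mulmx1C : E y *m (h *m (E y)^T *m diag_mx eps) = 1%:M.
    by rewrite !mulmxA oh DD.
  rewrite -!mulmxA => /(congr1 (mulmx (delta_mx 0 si : 'rV_(m + 1)))).
  rewrite mulmxA dh mulmx1.
  rewrite -scalemxAl -rowE => /rowP/(_ si) h1.
  rewrite mxE [row _ _ _ _]mxE [X in _ = X]mxE !eqxx /= in h1.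
  rewrite -[RHS]h1 mulrC mxE; congr (_ * _); apply: eq_bigr => i _.
  by rewrite mul_diag_mx [_^T _ _]mxE [in RHS]mxE; ring.
have S0 : S = (B ^+ 2 - f1 ^+ 2)^-1.
  by apply: (mulIf dB0); rewrite SE mulVf.
(* Summing [KE] over the frame produces the dimension [m + 1] of N, the origin of n in b^2 - n b',
   and lowers the coefficient of the f1^2 term from 2 to 1. *)
have : - B = S * (- derive1 (derive1 f) s + B1 / B * f1 ^+ 2) - B1 / B * (m + 1)%:R.
  have -> : (m + 1)%:R = \sum_(i < m + 1) 1 :> R by rewrite sumr_const card_ord.
  rewrite HN /S mulr_suml mulr_sumr -sumrB.
  apply: eq_bigr => i _; move: (KE i).
  move: ((_ *m _ *m _) 0 0) (eps 0 i) (E y i si) => D1 ep z h.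
  have -> : ep * (- (z ^+ 2 * derive1 (derive1 f) s) +
     (2 * (B1 / B) * f1 ^+ 2 * z ^+ 2 - B * B1 * D1)) =
     ep * (- (z ^+ 2 * derive1 (derive1 f) s) +
     2 * (B1 / B) * f1 ^+ 2 * z ^+ 2) - B * B1 * (ep * D1) by ring.
  by rewrite h; field.
rewrite S0; move: (derive1 (derive1 f) s) => f2 h.
have -> : f2 = (B ^+ 2 - f1 ^+ 2) * (- ((B ^+ 2 - f1 ^+ 2)^-1 * (- f2 + B1 / B * f1 ^+ 2)
    - B1 / B * (m + 1)%:R) - B1 / B * (m + 1)%:R) + B1 / B * f1 ^+ 2.
  by field; rewrite B0.
by rewrite -h; field.
Qed.

End MeanCurvatureEquation.

(** * From solitons over P x L to the differential equation for f *)

Section SolitonProfile.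
Context {R : realType} {m : nat} (P : riemannianManifold R m).
Variables (I : set R) (b f : R -> R) (L : set R).

Lemma C2_on_profile (ch : chart P) (p : P) : chart_dom ch p ->
    C2_on (N := prodLine P) [set x : P * R | L x.2] (fun x : P * R => f x.2) ->
  forall s, L s -> derivable f s 1 /\ derivable (derive1 f) s 1.
Proof.
move=> dp C2 s Ls; have [_ /(_ (rshift m ord0))[C1 [_ /(_ (rshift m ord0))[C2' _]]]] := C2 ch.
pose y : 'rV[R]_(m + 1) := coordL ch (p, s).
have ys : y 0 (rshift m ord0) = s by rewrite /y /coordL row_mxEr mxE.
have dy : (coordL ch @` ([set x : P * R | L x.2] `&` domL ch)) y by exists (p, s).
have e1 : (delta_mx 0 (rshift m ord0) : 'rV[R]_(m + 1)) 0 (rshift m ord0) = 1.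
  by rewrite mxE !eqxx.
have D h := (derive_coord_comp h (rshift m ord0) y (delta_mx 0 (rshift m ord0))).1.2.
rewrite ys e1 in D.
split; apply: D; first exact: C1 dy.
rewrite (_ : (fun _ => _) = pd (rshift m ord0) (fun z : 'rV[R]_(m + 1) => f (z 0 (rshift m ord0)))).
  exact: C2' dy.
by apply/funext => z; rewrite pd_coord_comp eqxx.
Qed.

Lemma soliton_profile s : [set: P] !=set0 -> open L -> L s ->
    derivable b (f s) 1 -> 0 < b (f s) ->
    Xsoliton (prodLine P) I b [set x : P * R | L x.2] (fun x : P * R => f x.2) ->
  [/\ I (f s), derivable f s 1, derivable (derive1 f) s 1,
    derive1 f s ^+ 2 != b (f s) ^+ 2 &
    derive1 (derive1 f) s =
      (b (f s) ^+ 2 - derive1 f s ^+ 2) * (b (f s) ^+ 2 - (m + 1)%:R * derive1 b (f s)) / b (f s)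
      + derive1 b (f s) / b (f s) * derive1 f s ^+ 2].
Proof.
move=> [p _] oL Ls db b0 [_ If C2 nd [D [A [[_ A0 _ _] sol]]]].
have [ch dp] := dom_cover p.
have [df ddf] := C2_on_profile dp C2 Ls.
pose y : 'rV[R]_(m + 1) := coordL ch (p, s).
have ys : y 0 (rshift m ord0) = s by rewrite /y /coordL row_mxEr mxE.
(* The flow at time 0 is the identity on I only, and f may leave I off L. *)
pose f0 r := A (f r) 0.
have f0E r : L r -> f0 r = f r.
  by move=> Lr; have /A0[_] : I (f r) by exact: (If (p, r)).
have nL r : L r -> \forall x \near r, L x by move=> Lr; apply: open_nbhs_nbhs.
have df0E r : L r -> derive1 f0 r = derive1 f r.
  move=> Lr; rewrite !derive1E; apply: near_eq_derive.
  by apply: filterS (nL r Lr) => x; exact: f0E.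
have nd0 : \forall x \near s, derive1 f x = derive1 f0 x.
  by apply: filterS (nL s Ls) => x /df0E.
have ddf0 : derivable (derive1 f0) s 1 by apply: near_eq_derivable ddf.
have ddf0E : derive1 (derive1 f0) s = derive1 (derive1 f) s.
  by rewrite [LHS]derive1E [RHS]derive1E; apply/esym/near_eq_derive.
(* The soliton condition holds near t = 0, hence at t = 0, the only time that is used. *)
have := nbhs_singleton (sol (p, s) Ls) ch dp => /= mc.
have hu : pullback (grw_metric (N := prodLine P) b ch)
   (graph_map (N := prodLine P) ch (fun x => f0 x.2)) y \in unitmx.
  have := nd ch (p, s) Ls dp; rewrite -/y.
  have -> := pullback_graph ch b f y; have -> := pullback_graph ch b f0 y.
  rewrite /slope_covector ys (f0E s Ls) (df0E s Ls); exact: id.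
have dy : (coordL ch @` domL ch) y by exists (p, s).
have := @graph_mean_curvature_eq R m P ch b f0 y dy.
rewrite ys (f0E s Ls) (df0E s Ls) ddf0E.
case/(_ ddf0 db b0 hu).
  have : f0 s = f s by exact: f0E.
  by move: mc; rewrite -[A (f s) 0]/(f0 s) => mc <-.
by move=> h1 h2; split => //; exact: (If (p, s)).
Qed.

End SolitonProfile.

(** * The profile equation *)

Section WarpPrimitive.
Context {R : realType}.
Variables (w : warp) (n : nat) (c : R).
Hypotheses (hn : (1 <= n)%N) (hc : 0 < c).

Let b := warp_fun w n c.
Let d := warp_cst w n c.

Lemma warp_rate_gt0 : 0 < c ^+ 2 * n%:R ^+ 2.
Proof. by rewrite mulr_gt0 ?exprn_gt0 ?ltr0n. Qed.

Lemma warp_cst_sqr : d ^+ 2 = (c ^+ 2 * n%:R ^+ 2) ^+ 2.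
Proof. by rewrite /d; case: w => //=; rewrite sqrrN. Qed.

Lemma warp_cst_neq0 : d != 0.
Proof. by rewrite -sqrf_eq0 warp_cst_sqr sqrf_eq0 gt_eqF ?warp_rate_gt0. Qed.

Definition warp_base (w : warp) (x : R) : R :=
  match w with
  | II => sin x
  | III => (expR (- x) - expR x) / 2
  end.

Definition warp_base' (w : warp) (x : R) : R :=
  match w with
  | II => cos x
  | III => - ((expR (- x) + expR x) / 2)
  end.

Definition warp_bot (w : warp) : R := match w with II => 1 | III => 0 end.

Lemma warp_bot_ge0 : 0 <= warp_bot w.
Proof. by case: w => /=. Qed.

Lemma warp_domII (t : R) : warp_dom II c t = (0 < c * t < pi / 2) :> Prop.
Proof.
rewrite /= in_itv /= pmulr_rgt0 //; congr is_true; congr (_ && _).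
by rewrite invfM mulrA ltr_pdivlMr // mulrC.
Qed.

Lemma warp_domIII (t : R) : warp_dom III c t = (c * t < 0) :> Prop.
Proof. by rewrite /= in_itv /= pmulr_rlt0. Qed.

Lemma warp_base_gt0 t : warp_dom w c t -> 0 < warp_base w (c * t).
Proof.
case: w; rewrite ?warp_domII ?warp_domIII /=; first exact: sin_gt0_pihalf.
by move=> ct; rewrite divr_gt0 // subr_gt0 ltr_expR; lra.
Qed.

Lemma is_derive_warp_base (x : R) : is_derive x 1 (warp_base w) (warp_base' w x).
Proof.
case: w => /=; first exact: is_derive_sin.
have D1 : is_derive x 1 (fun x : R => expR (- x)) (expR (- x) * -1).
  exact: (is_derive1_comp (is_derive_expR (- x)) (is_deriveN (is_derive_id x 1))).
have D2 : is_derive x 1 (fun x : R => expR (- x) - expR x) _ :=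
  is_deriveB D1 (is_derive_expR x).
have D := is_deriveZ 2^-1 D2.
have -> : warp_base III = 2^-1 \*: (fun x : R => expR (- x) - expR x).
  by apply/funext => y; rewrite /= /GRing.scale /= mulrC.
by apply: (is_derive_eq D); rewrite /GRing.scale /=; field.
Qed.

(** The identity (log phi^-n)' = d/b with its denominators cleared. It lets both warps share the
    derivative of [warp_prim]. *)
Lemma warp_funE t : warp_dom w c t ->
  b t * warp_base' w (c * t) * (n%:R * c) = - d * warp_base w (c * t) /\ 0 < b t.
Proof.
have nc : 0 < n%:R * c by rewrite mulr_gt0 ?ltr0n.
rewrite /b /d; case: w; rewrite ?warp_domII ?warp_domIII /=.
  move=> /andP[t0 t1].
  have C : 0 < cos (c * t).
    by apply: cos_gt0_pihalf; rewrite t1 andbT; have := pi_gt0 R; lra.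
  have S : 0 < sin (c * t) by apply: sin_gt0_pihalf; rewrite t0.
  split; last by rewrite mulr_gt0 // divr_gt0.
  by rewrite /tan; field; rewrite gt_eqF.
move=> t0; rewrite /tanh.
have h : expR (c * t) < expR (- (c * t)) by rewrite ltr_expR; lra.
have p : 0 < expR (c * t) + expR (- (c * t)) by rewrite addr_gt0 ?expR_gt0.
split; first by field; rewrite gt_eqF.
by rewrite -mulrN mulr_gt0 // -mulNr divr_gt0 //; lra.
Qed.

Lemma warp_fun_gt0 t : warp_dom w c t -> 0 < b t.
Proof. by move=> /warp_funE[]. Qed.

Lemma open_warp_dom : open (warp_dom w c).
Proof. by case: w; exact: interval_open. Qed.

Lemma is_derive_scale (t : R) : is_derive t 1 (fun x : R => c * x) c.
Proof. by have := is_deriveZ c (is_derive_id t 1); rewrite /GRing.scale /= mulr1. Qed.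

Lemma is_derive_warp_fun (t : R) : warp_dom w c t -> is_derive t 1 b (derive1 b t).
Proof.
move=> It; rewrite derive1E; apply/derivableP.
have Dc := is_derive_scale t.
move: It; rewrite /b; case: w; rewrite ?warp_domII ?warp_domIII /=.
  move=> /andP[t0 t1]; have ct : cos (c * t) != 0.
    by rewrite gt_eqF // cos_gt0_pihalf // t1 andbT; have := pi_gt0 R; lra.
  by have [] := is_deriveZ (n%:R * c) (is_derive1_comp (is_derive_tan ct) Dc).
move=> t0.
by have [] := is_deriveN (is_deriveZ (n%:R * c)
  (is_derive1_comp (is_derive_tanh (c * t)) Dc)).
Qed.

Definition warp_prim (t : R) : R := (warp_base w (c * t) ^+ n)^-1.

Local Notation Z := warp_prim.

Lemma is_derive_warp_prim (t : R) : warp_dom w c t ->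
  is_derive t 1 Z (d * Z t / b t).
Proof.
move=> It; have [E b0] := warp_funE It; have S0 := warp_base_gt0 It.
have D := is_derive1_comp (is_derive_warp_base (c * t)) (is_derive_scale t).
have Dp := DeriveDef (@exprn_derivable R n (warp_base w (c * t)) 1) (@exp_derive R n _ _).
have Dn := @is_derive1_comp R (fun x => x ^+ n) (warp_base w \o *%R c) t _ _ Dp D.
have S0' : warp_base w (c * t) ^+ n != 0 by rewrite expf_eq0 gt_eqF ?andbF.
have DZ : is_derive t 1 Z _ := @is_deriveV R _ t _ 1 S0' Dn.
apply: (is_derive_eq DZ).
rewrite /warp_prim /= /GRing.scale /=.
have {}S0' : warp_base w (c * t) != 0 by rewrite gt_eqF.
have b0' : b t != 0 by rewrite gt_eqF.
have nc0 : n%:R * c != 0 by rewrite mulf_neq0 ?pnatr_eq0 ?gt_eqF // -lt0n.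
apply: (mulfI b0'); rewrite [RHS]mulrC divfK //.
have -> : d = - (b t * warp_base' w (c * t) * (n%:R * c) / warp_base w (c * t)).
  by rewrite E mulNr mulNr mulfK // opprK.
have -> : warp_base w (c * t) ^+ n = warp_base w (c * t) ^+ n.-1 * warp_base w (c * t).
  by rewrite -exprSr prednK.
by field; rewrite expf_neq0 S0'.
Qed.

Lemma warp_prim_gt t : warp_dom w c t -> warp_bot w < Z t.
Proof.
move=> It; have := warp_base_gt0 It; rewrite /Z; move: It.
case: w; rewrite ?warp_domII ?warp_domIII /= => It S0; last first.
  by rewrite invr_gt0 exprn_gt0.
rewrite -invr1 ltf_pV2 ?posrE ?exprn_gt0 // exprn_ilt1 ?ltW -?lt0n //.
rewrite -sin_pihalf ltr_sin ?in_itv /= -?andbA; have := pi_gt0 R.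
- by case/andP: It.
- by move=> p; apply/andP; split; lra.
- by move=> p; apply/andP; split; lra.
Qed.

Lemma warp_prim_lt s t : warp_dom w c s -> warp_dom w c t -> s < t ->
  match w with II => Z t < Z s | III => Z s < Z t end.
Proof.
move=> Is It st; have := warp_base_gt0 Is; have := warp_base_gt0 It.
move: Is It; rewrite /Z; have cst : c * s < c * t by rewrite ltr_pM2l.
case: w; rewrite ?warp_domII ?warp_domIII /= => Is It S0 S1;
  rewrite ltf_pV2 ?posrE ?exprn_gt0 // ltrXn2r -?lt0n ?ltW //.
  by rewrite ltr_sin // in_itv /=; apply/andP; split; lra.
rewrite ltr_pM2r // ltrD ?ltrN2 ?ltr_expR //; lra.
Qed.

Lemma warp_prim_inj s t : warp_dom w c s -> warp_dom w c t -> Z s = Z t -> s = t.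
Proof.
move=> Is It E; case: (ltgtP s t) => // st.
  by have := warp_prim_lt Is It st; rewrite E; case: w; rewrite ltxx.
by have := warp_prim_lt It Is st; rewrite E; case: w; rewrite ltxx.
Qed.

Lemma warp_prim_surj y : warp_bot w < y -> exists2 t, warp_dom w c t & Z t = y.
Proof.
move=> y1; have y0 : 0 < y := le_lt_trans warp_bot_ge0 y1.
(* [r] is y^(-1/n), the value phi must take for phi^-n to equal y. *)
pose r := expR (- ln y / n%:R); have r0 : 0 < r by exact: expR_gt0.
have rn : (r ^+ n)^-1 = y.
  rewrite /r -expRM_natr divfK ?pnatr_eq0 -?lt0n // expRN invrK lnK //.
suff [x Ix xr] : exists2 x, warp_dom w c (x / c) & warp_base w x = r.
  by exists (x / c) => //; rewrite /Z mulrC divfK ?gt_eqF // xr.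
move: y1; case: w => y1; rewrite /= in y1.
  have r1 : r < 1.
    by rewrite /r expR_lt1 mulNr oppr_lt0 divr_gt0 ?ln_gt0 ?ltr0n.
  have rE : sin (asin r) = r by rewrite asinK // in_itv /=; apply/andP; split; lra.
  exists (asin r) => //; rewrite warp_domII mulrC divfK ?gt_eqF //.
  rewrite asin_ltpi2 ?r1 ?andbT; last by lra.
  rewrite ltNge; apply/negP => a0; suff : r <= 0 by lra.
  suff : sin (asin r) <= sin 0 by rewrite rE sin0.
  rewrite le_eqVlt; move: a0; rewrite le_eqVlt => /orP[/eqP->|a0].
    by rewrite eqxx.
  rewrite ltr_sin ?a0 ?orbT // in_itv /=; have := pi_gt0 R;
    last by move=> p; apply/andP; split; lra.
  rewrite asin_geNpi2 ?asin_lepi2 //; apply/andP; split; lra.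
(* Here sinh(-x) = r is solved by the explicit inverse hyperbolic sine; (q + r)(q - r) = 1 gives the
   reciprocal exponential. *)
pose q := Num.sqrt (r ^+ 2 + 1).
have q2 : q ^+ 2 = r ^+ 2 + 1 by rewrite sqr_sqrtr // addr_ge0 ?sqr_ge0.
have q1 : 1 < r + q.
  have : 0 <= q by exact: sqrtr_ge0.
  by nra.
have ql : 0 < ln (r + q) by rewrite ln_gt0.
exists (- ln (r + q)).
  by rewrite warp_domIII mulrC divfK ?gt_eqF // oppr_lt0.
rewrite /= opprK expRN lnK ?posrE; last by lra.
have -> : (r + q)^-1 = q - r.
  apply: (@mulfI _ (r + q)); first by rewrite gt_eqF //; lra.
  rewrite divff; last by rewrite gt_eqF //; lra.
  by ring: q2.
by field.
Qed.

End WarpPrimitive.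

Section Calculus1.
Context {R : realType}.

(** Uniqueness for the differential equation enters through this lemma, applied to the two first
    integrals in [profile_exp_comb]. *)
Lemma is_derive0_itv_cst (L : set R) (f : R -> R) : is_interval L ->
  (forall s, L s -> is_derive s 1 f 0) -> forall s t, L s -> L t -> f s = f t.
Proof.
move=> iL Df; suff W s t : L s -> L t -> s <= t -> f s = f t.
  by move=> s t Ls Lt; case: (leP s t) => [|/ltW] /W => [->|->].
move=> Ls Lt st.
have sub x : x \in `[s, t] -> L x.
  by rewrite in_itv /= => x_st; exact: iL Ls Lt _ x_st.
have cf : {within `[s, t], continuous f}.
  by apply: derivable_within_continuous => x /sub /Df[].
have [x /subset_itv_oo_cc /sub /Df //|x _] := MVT_segment (df := fun=> 0) st _ cf.
by rewrite mul0r => /subr0_eq.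
Qed.

End Calculus1.

(** * Every solution comes from a combination of two exponentials *)

Section ProfileEquation.
Context {R : realType}.
Variables (w : warp) (n : nat) (c : R).
Hypotheses (hn : (1 <= n)%N) (hc : 0 < c).

Let b := warp_fun w n c.
Let d := warp_cst w n c.
Let a := c ^+ 2 * n%:R ^+ 2.
Local Notation Z := (warp_prim w n c).

Let a0 : 0 < a. Proof. exact: warp_rate_gt0. Qed.
Let d2 : d ^+ 2 = a ^+ 2. Proof. exact: warp_cst_sqr. Qed.
Let d0 : d != 0. Proof. exact: warp_cst_neq0. Qed.

Definition exp_comb (al be s : R) : R := al * expR (a * s) + be * expR (- (a * s)).

Lemma is_derive_expMl (k s : R) :
  is_derive s 1 (fun x => expR (k * x)) (k * expR (k * s)).
Proof.
by rewrite [k * expR _]mulrC; exact: (is_derive1_comp (is_derive_expR _) (is_derive_scale k s)).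
Qed.

(** The f'^2 term of the ODE is exactly what the quotient rule subtracts when f'/b(f) is
    differentiated, so the slope obeys an equation free of b. *)
Lemma profile_slope (L : set R) (F : R -> R) : profile_solution w n c L F ->
  forall s, L s ->
    is_derive s 1 (Z \o F) (d * (derive1 F s / b (F s)) * Z (F s)) /\
    is_derive s 1 (fun s => derive1 F s / b (F s))
                  (d * (1 - (derive1 F s / b (F s)) ^+ 2)).
Proof.
move=> [_ _ _ sol] s /sol[IF dF ddF E].
have DF : is_derive s 1 F (derive1 F s) by rewrite derive1E; exact/derivableP.
have DF' : is_derive s 1 (derive1 F) (derive1 (derive1 F) s).
  by rewrite [derive1 _ s]derive1E; exact/derivableP.
have b0 : b (F s) != 0 by rewrite gt_eqF // warp_fun_gt0.
have Db := is_derive1_comp (is_derive_warp_fun n hc IF) DF.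
split.
  apply: (is_derive_eq (is_derive1_comp (is_derive_warp_prim hn hc IF) DF)).
  by rewrite -/d -/b; field.
have D : is_derive s 1 (fun s => derive1 F s / b (F s)) _ :=
  is_deriveM DF' (@is_deriveV R (b \o F) s _ 1 b0 Db).
apply: (is_derive_eq D); rewrite E /GRing.scale /= -/b -/d.
by field.
Qed.

Lemma profile_exp_comb (L : set R) (F : R -> R) : profile_solution w n c L F ->
  exists al be, forall s, L s ->
    Z (F s) = exp_comb al be s /\
    1 - derive1 F s ^+ 2 / b (F s) ^+ 2 = 4 * al * be / Z (F s) ^+ 2.
Proof.
move=> sol; have [_ iL [s0 Ls0] sol'] := sol.
pose v s := derive1 F s / b (F s).
(* (Y' + aY) e^(-as) and (aY - Y') e^(as) are constant: the cases k = -a and k = a. *)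
have DK k s : L s -> k ^+ 2 = d ^+ 2 ->
    is_derive s 1 (fun s => expR (k * s) * ((k - d * v s) * Z (F s))) 0.
  move=> Ls kd; have [DZ Dv] := profile_slope sol Ls.
  have D1 : is_derive s 1 (fun s => k - d * v s) _ :=
    is_deriveB (is_derive_cst k s 1) (is_deriveZ d Dv).
  have D2 : is_derive s 1 (fun s => (k - d * v s) * Z (F s)) _ := is_deriveM D1 DZ.
  have D : is_derive s 1 (fun s => expR (k * s) * ((k - d * v s) * Z (F s))) _ :=
    is_deriveM (is_derive_expMl k s) D2.
  apply: (is_derive_eq D); rewrite /GRing.scale /= -/(v s).
  by ring: kd.
have Na2 : (- a) ^+ 2 = d ^+ 2 by rewrite sqrrN.
pose K k := expR (k * s0) * ((k - d * v s0) * Z (F s0)).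
have EK k s : k ^+ 2 = d ^+ 2 -> L s ->
    (k - d * v s) * Z (F s) = K k * expR (- (k * s)).
  move=> kd Ls; rewrite expRN /K.
  rewrite (is_derive0_itv_cst iL (fun x Lx => DK k x Lx kd) Ls0 Ls).
  by rewrite [RHS]mulrC /= mulKf // gt_eqF ?expR_gt0.
(* The two first integrals give (a - d v) Z and (-a - d v) Z; their difference is 2 a Z. *)
exists (- K (- a) / (2 * a)), (K a / (2 * a)) => s Ls.
have := EK a s (esym d2) Ls; have := EK (- a) s Na2 Ls.
rewrite mulNr opprK => E1 E2.
have [IF _ _ _] := sol' s Ls.
have Z0 : Z (F s) != 0.
  by rewrite gt_eqF // (le_lt_trans _ (warp_prim_gt hn hc IF)) // warp_bot_ge0.
have a0' : a != 0 by rewrite gt_eqF.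
have b0 : b (F s) != 0 by rewrite gt_eqF // warp_fun_gt0.
split.
  have -> : exp_comb (- K (- a) / (2 * a)) (K a / (2 * a)) s =
     (K a * expR (- (a * s)) - K (- a) * expR (a * s)) / (2 * a).
    by rewrite /exp_comb; field.
  by rewrite -E1 -E2; field.
have EE : expR (a * s) * expR (- (a * s)) = 1 by rewrite -expRD subrr expR0.
(* In the product of the two first integrals the exponentials cancel, leaving (a^2 - d^2 v^2) Z^2 up
   to sign; with d^2 = a^2 this is the causal quantity. *)
have -> : 4 * (- K (- a) / (2 * a)) * (K a / (2 * a)) =
   - (K a * expR (- (a * s))) * (K (- a) * expR (a * s)) / a ^+ 2.
  by field: EE.
rewrite -E1 -E2 /v -expr_div_n -/(v s).
have -> : - ((a - d * v s) * Z (F s)) * ((- a - d * v s) * Z (F s)) =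
   (a ^+ 2 - d ^+ 2 * v s ^+ 2) * Z (F s) ^+ 2 by ring.
by rewrite d2; field; rewrite Z0 a0'.
Qed.

End ProfileEquation.

(** * Conversely, solutions from combinations of exponentials, and the intervals they live on *)

Section ProfileSolutions.
Context {R : realType}.
Variables (w : warp) (n : nat) (c : R).
Hypotheses (hn : (1 <= n)%N) (hc : 0 < c).

Let b := warp_fun w n c.
Let d := warp_cst w n c.
Let a := c ^+ 2 * n%:R ^+ 2.
Local Notation Z := (warp_prim w n c).
Local Notation E := (exp_comb n c).

Let a0 : 0 < a. Proof. exact: warp_rate_gt0. Qed.
Let d2 : d ^+ 2 = a ^+ 2. Proof. exact: warp_cst_sqr. Qed.
Let d0 : d != 0. Proof. exact: warp_cst_neq0. Qed.

(* The junk value 0 is taken for y <= warp_bot w. *)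
Definition warp_inv (y : R) : R := xget 0 [set t | warp_dom w c t /\ Z t = y].
Local Notation T := warp_inv.

Lemma warp_invP y : warp_bot w < y -> warp_dom w c (T y) /\ Z (T y) = y.
Proof.
move=> /(warp_prim_surj hn hc)[t It Zt].
by apply: (@xgetPex _ 0 [set t | warp_dom w c t /\ Z t = y]); exists t.
Qed.

Lemma warp_invK t : warp_dom w c t -> T (Z t) = t.
Proof.
move=> It; have [IT ZT] := warp_invP (warp_prim_gt hn hc It).
exact: (warp_prim_inj hn hc IT It ZT).
Qed.

Lemma is_derive_warp_inv (y : R) : warp_bot w < y ->
  is_derive y 1 T (b (T y) / (d * y)).
Proof.
move=> hy; have [IT ZT] := warp_invP hy.
have y0 : y != 0 by rewrite gt_eqF // (le_lt_trans _ hy) // warp_bot_ge0.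
have b0 : b (T y) != 0 by rewrite gt_eqF // warp_fun_gt0.
have DZ := is_derive_warp_prim hn hc IT; rewrite ZT -/d -/b in DZ.
have NI : \forall t \near T y, warp_dom w c t.
  by apply: open_nbhs_nbhs; split => //; exact: open_warp_dom.
rewrite -{1}ZT (_ : b (T y) / (d * y) = (d * y / b (T y))^-1); last first.
  by rewrite invf_div.
apply: is_derive_inverse DZ _ => /=.
- by apply: filterS NI => t; exact: warp_invK.
- apply: filterS NI => t It; apply/differentiable_continuous/derivable1_diffP.
  by case: (is_derive_warp_prim hn hc It).
- by rewrite !mulf_neq0 ?invr_eq0.
Qed.

Lemma is_derive_exp_comb (al be s : R) :
  is_derive s 1 (E al be) (a * E al (- be) s).
Proof.
have D1 := is_deriveZ al (is_derive_expMl a s).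
have D2 := is_deriveZ be (is_derive_expMl (- a) s).
have -> : E al be = (fun s => al *: expR (a * s)) + (fun s => be *: expR (- a * s)).
  by apply/funext => x; rewrite /exp_comb !fctE -/a mulNr.
apply: (is_derive_eq (is_deriveD D1 D2)).
by rewrite /exp_comb -/a /GRing.scale /= !mulNr; ring.
Qed.

Lemma exp_combN (al be s : R) : E al be (- s) = E be al s.
Proof. by rewrite /exp_comb mulrN opprK addrC. Qed.

Lemma profile_solution_warp_inv (U : set R) (al be : R) :
    open U -> is_interval U -> U !=set0 -> (forall s, U s -> warp_bot w < E al be s) ->
  profile_solution w n c U (T \o E al be).
Proof.
move=> oU iU U0 hU; split => // s Us.
pose F := T \o E al be.
(* The derivative of [F] by the chain rule, written out so that it can be differentiated again; it
   agrees with [derive1 F] near each point of [U]. *)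
pose G s := b (F s) * (a * E al (- be) s / (d * E al be s)).
have DF x : U x -> is_derive x 1 F (G x).
  move=> Ux; have := is_derive1_comp (is_derive_warp_inv (hU _ Ux)) (is_derive_exp_comb al be x).
  by move=> D; apply: (is_derive_eq D); rewrite /G -/(T (E al be x)) /F /= -mulrA [_^-1 * _]mulrC.
have F'E : \near s, G s = derive1 F s.
  have : \forall x \near s, U x by apply: open_nbhs_nbhs; split.
  by apply: filterS => x /DF Dx; rewrite derive1E; apply/esym/derive_val.
have [IF ZF] := warp_invP (hU _ Us).
have F's : derive1 F s = G s by rewrite derive1E; have D := DF s Us; exact: derive_val.
have y0 : E al be s != 0.
  by rewrite gt_eqF // (le_lt_trans _ (hU _ Us)) // warp_bot_ge0.
have b0 : b (F s) != 0 by rewrite gt_eqF // warp_fun_gt0.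
have Db := @is_derive1_comp R b F s _ _ (is_derive_warp_fun n hc IF) (DF s Us).
have DY := is_deriveZ d (is_derive_exp_comb al be s).
have dy0 : d * E al be s != 0 by rewrite mulf_neq0.
have DV := @is_deriveV R (d \*: E al be) s _ 1 dy0 DY.
have DY1 := is_deriveZ a (is_derive_exp_comb al (- be) s).
have DG : is_derive s 1 G _ := is_deriveM Db (is_deriveM DY1 DV).
have DF' := near_eq_is_derive F'E DG.
split => //; first by case: (DF s Us).
have -> : derive1 (derive1 (T \o E al be)) s = _ :=
  etrans (derive1E _ _) (@derive_val _ _ _ _ _ _ _ DF').
rewrite -/F F's /G !fctE /F /= /GRing.scale /= opprK.
rewrite -/(T (E al be s)) -/b -/d.
by field: d2; apply/and3P.
Qed.

(** Multiplied by e^(as), the equality reads (al - al') e^(2as) = be' - be. Two distinct points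
    suffice, and openness provides them. *)
Lemma exp_comb_inj (L : set R) (al be al' be' : R) : open L -> L !=set0 ->
  (forall s, L s -> E al be s = E al' be' s) -> al = al' /\ be = be'.
Proof.
move=> oL [s Ls] h.
have /nbhs_ballP[e /= e0 eL] : nbhs s L by apply: open_nbhs_nbhs; split.
have Lt : L (s + e / 2).
  apply: eL; rewrite /ball /= opprD addNKr normrN gtr0_norm ?divr_gt0 //.
  by rewrite ltr_pdivrMr // ltr_pMr // ltr1n.
have := h _ Ls; have := h _ Lt; rewrite /exp_comb -/a !expRN.
have : expR (a * s) < expR (a * (s + e / 2)).
  by rewrite ltr_expR ltr_pM2l // ltrDl divr_gt0.
move: (expR_gt0 (a * s)) (expR_gt0 (a * (s + e / 2))).
move: (expR (a * s)) (expR (a * (s + e / 2))) => x y x0 y0 xy hy hx.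
have x0' : x != 0 by rewrite gt_eqF.
have y0' : y != 0 by rewrite gt_eqF.
have h1 : (al - al') * x ^+ 2 = be' - be.
  have -> : (al - al') * x ^+ 2 = ((al * x + be / x) - (al' * x + be' / x)) * x + be' - be.
    by field.
  by rewrite hx subrr mul0r add0r.
have h2 : (al - al') * y ^+ 2 = be' - be.
  have -> : (al - al') * y ^+ 2 = ((al * y + be / y) - (al' * y + be' / y)) * y + be' - be.
    by field.
  by rewrite hy subrr mul0r add0r.
have h3 : (al - al') * (y ^+ 2 - x ^+ 2) = 0 by rewrite mulrBr h1 h2 subrr.
have al_eq : al = al'.
  apply/eqP; rewrite -subr_eq0; move/eqP: h3; rewrite mulf_eq0 => /orP[//|].
  by rewrite gt_eqF // subr_gt0 ltr_pXn2r // nnegrE ltW.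
split=> //; apply/esym/eqP; rewrite -subr_eq0 -h1 al_eq subrr mul0r //.
Qed.

(** Each case keeps what the classification consumes: the sign of the coefficient dominating at an
    infinite end, the value [y0] at the finite end, which blocks any extension, and the implication
    that rules out spacelike half-lines when [y0] is 0. *)
Definition positivity_component (al be y0 : R) (U : set R) : Prop :=
  [\/ [/\ U = setT, 0 < al, 0 < be & forall s, y0 < E al be s],
      exists k, [/\ U = `]k, +oo[%classic, 0 < al, E al be k = y0,
        forall s, k < s -> y0 < E al be s & 0 < al * be -> 0 < y0] |
      exists k, [/\ U = `]-oo, k[%classic, 0 < be, E al be k = y0,
        forall s, s < k -> y0 < E al be s & 0 < al * be -> 0 < y0]].

Lemma exp_comb_component_pos (al be y0 : R) (L : set R) :
    is_interval L -> 0 <= y0 -> 0 < al -> be != 0 ->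
    (forall s, L s -> y0 < E al be s) ->
  exists2 U, L `<=` U & positivity_component al be y0 U.
Proof.
move=> iL hy0 al0 be0 hL.
have e0 s : 0 < expR (a * s) by exact: expR_gt0.
pose D := y0 ^+ 2 - 4 * al * be.
have EP s : y0 < E al be s =
    (0 < al * expR (a * s) ^+ 2 - y0 * expR (a * s) + be).
  rewrite -[RHS](pmulr_lgt0 _ (_ : 0 < (expR (a * s))^-1)) ?invr_gt0 // -subr_gt0.
  by congr (0 < _); rewrite /exp_comb -/a expRN; field; rewrite gt_eqF.
have E0 s : al * expR (a * s) ^+ 2 - y0 * expR (a * s) + be = 0 -> E al be s = y0.
  move=> h; apply/eqP; rewrite -subr_eq0 /exp_comb -/a expRN.
  rewrite (_ : _ - _ = (al * expR (a * s) ^+ 2 - y0 * expR (a * s) + be) / expR (a * s)).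
    by rewrite h mul0r.
  by field; rewrite gt_eqF.
have [D0|D0] := ltP D 0.
  exists setT => //; apply: Or31.
  have be_gt0 : 0 < be by rewrite /D in D0; nra.
  split => // s; rewrite EP; rewrite /D in D0; have := e0 s; move: (expR _) => x x0.
  by rewrite -(pmulr_lgt0 _ al0); have := sqr_ge0 (2 * al * x - y0); nra.
pose r := Num.sqrt D; have r0 : 0 <= r by exact: sqrtr_ge0.
have r2 : r ^+ 2 = y0 ^+ 2 - 4 * al * be by rewrite sqr_sqrtr.
pose x1 := (y0 + r) / (2 * al); pose x2 := (y0 - r) / (2 * al).
have al2 : 0 < 2 * al by rewrite mulr_gt0.
have al0' : al != 0 by rewrite gt_eqF.
have fact x : al * x ^+ 2 - y0 * x + be = al * (x - x1) * (x - x2).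
  have -> : al * (x - x1) * (x - x2) = al * x ^+ 2 - y0 * x + (y0 ^+ 2 - r ^+ 2) / (4 * al).
    by rewrite /x1 /x2; field.
  by rewrite r2; field.
(* If both [y0] and [r] vanished, the discriminant would give [al * be = 0]. *)
have yr : 0 < y0 + r.
  rewrite lt_neqAle addr_ge0 // andbT; apply/eqP => yr.
  have y0r : y0 = 0 by lra.
  have rr : r = 0 by lra.
  move/eqP: r2; rewrite rr y0r !expr0n /= sub0r eq_sym oppr_eq0 !mulf_eq0.
  by rewrite (negbTE al0') (negbTE be0) pnatr_eq0.
have x1_gt0 : 0 < x1 by rewrite divr_gt0.
have x21 : x2 <= x1 by rewrite ler_pM2r ?invr_gt0 //; lra.
have y_gt0 : 0 < al * be -> 0 < y0.
  move=> albe; rewrite lt_neqAle hy0 andbT; apply/eqP => y00.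
  by have := sqr_ge0 r; rewrite r2 -y00; nra.
have lnE x : 0 < x -> expR (a * (ln x / a)) = x.
  by move=> x0; rewrite mulrC divfK ?gt_eqF // lnK.
have ltE x s : 0 < x -> (ln x / a < s) = (x < expR (a * s)).
  by move=> x0; rewrite -{2}(lnE x x0) ltr_expR ltr_pM2l.
have gtE x s : 0 < x -> (s < ln x / a) = (expR (a * s) < x).
  by move=> x0; rewrite -{2}(lnE x x0) ltr_expR ltr_pM2l.
have [Lx1|] := pselect (forall s, L s -> x1 < expR (a * s)).
  exists `]ln x1 / a, +oo[%classic.
    by move=> s /Lx1; rewrite /= in_itv /= ltE ?andbT.
  apply: Or32; exists (ln x1 / a); split => //.
    by apply: E0; rewrite fact lnE // subrr mulr0 mul0r.
  move=> s; rewrite ltE // EP fact => h.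
  by rewrite !mulr_gt0 // subr_gt0 //; apply: le_lt_trans h.
(* Some point of [L] is not beyond the larger root; positivity then puts it below the smaller root
   [x2]. This forces [x2] and hence [be] to be positive, and the interval [L] cannot cross [x2]. *)
move=> /existsNP[s1 /not_implyP[Ls1 /negP]]; rewrite -leNgt => s1x1.
have s1x2 : expR (a * s1) < x2.
  have := hL _ Ls1; rewrite EP fact -mulrA pmulr_rgt0 // => h.
  rewrite ltNge; apply/negP => h'; move: h; rewrite ltNge mulr_le0_ge0 ?subr_le0 ?subr_ge0 //.
have x2_gt0 : 0 < x2 by exact: lt_trans s1x2.
have Ek : E al be (ln x2 / a) = y0 by apply: E0; rewrite fact lnE // subrr mulr0.
have be_gt0 : 0 < be.
  have := fact 0; rewrite expr0n /= !mulr0 !sub0r oppr0 add0r => ->.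
  by rewrite !(mulrN, mulNr) opprK; exact: mulr_gt0 (mulr_gt0 al0 x1_gt0) x2_gt0.
exists `]-oo, ln x2 / a[%classic.
  move=> s Ls; rewrite /= in_itv /= ltNge; apply/negP => h.
  suff /hL : L (ln x2 / a) by rewrite Ek ltxx.
  by apply: iL Ls1 Ls _ _; rewrite h andbT ltW // gtE.
apply: Or33; exists (ln x2 / a); split => // s; rewrite gtE // EP fact => h.
rewrite -mulrA pmulr_rgt0 // nmulr_rgt0 subr_lt0 //.
exact: lt_le_trans h x21.
Qed.

(** Positivity at one point makes [al] or [be] positive, and the reflection s |-> -s exchanges
    them. *)
Lemma exp_comb_component (al be y0 : R) (L : set R) :
    is_interval L -> L !=set0 -> 0 <= y0 -> al * be != 0 ->
    (forall s, L s -> y0 < E al be s) ->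
  exists2 U, L `<=` U & positivity_component al be y0 U.
Proof.
move=> iL [s0 Ls0] hy0; rewrite mulf_eq0 negb_or => /andP[al0 be0] hL.
have [al_gt0|al_lt0] := ltP 0 al; first exact: exp_comb_component_pos.
have be_gt0 : 0 < be.
  have := le_lt_trans hy0 (hL _ Ls0); rewrite /exp_comb.
  move: (expR_gt0 (a * s0)) (expR_gt0 (- (a * s0))); rewrite -/a.
  move: (expR _) (expR _) => x y x0 y0'; nra.
have iNL : is_interval [set s | L (- s)].
  move=> x y Lx Ly z /andP[xz zy]; apply: iL Ly Lx _ _.
  by rewrite !lerN2 xz zy.
have [U LU CU] := exp_comb_component_pos iNL hy0 be_gt0 al0
  (fun s (Ls : L (- s)) => eq_ind _ (fun z => is_true (y0 < z)) (hL _ Ls) _ (exp_combN al be s)).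
exists [set s | U (- s)]; first by move=> s Ls; apply: LU; rewrite /= opprK.
case: CU => [[-> ? ? h]|[k [-> ? Ek h ?]]|[k [-> ? Ek h ?]]].
- apply: Or31; split => // s; rewrite -[s]opprK exp_combN; exact: h.
- apply: Or33; exists (- k); split => //.
  + by apply/seteqP; split=> s /=; rewrite !in_itv /= andbT ltrNr.
  + by rewrite exp_combN.
  + by move=> s ks; rewrite -[s]opprK exp_combN; apply: h; rewrite ltrNr.
  + by rewrite mulrC.
- apply: Or32; exists (- k); split => //.
  + by apply/seteqP; split=> s /=; rewrite !in_itv /= andbT ltrNl.
  + by rewrite exp_combN.
  + by move=> s ks; rewrite -[s]opprK exp_combN; apply: h; rewrite ltrNl.
  + by rewrite mulrC.
Qed.

End ProfileSolutions.

(** * Maximal extensions and their classification *)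

Section Classify.
Context {R : realType}.
Variables (w : warp) (n : nat) (c : R).
Hypotheses (hn : (1 <= n)%N) (hc : 0 < c).

Let b := warp_fun w n c.
Let a := c ^+ 2 * n%:R ^+ 2.
Local Notation Z := (warp_prim w n c).
Local Notation E := (exp_comb n c).
Local Notation T := (warp_inv w n c).
Implicit Types (L U M : set R) (F f : R -> R).

Let a0 : 0 < a. Proof. exact: warp_rate_gt0. Qed.

Lemma positivity_componentP al be y0 U : positivity_component n c al be y0 U ->
  [/\ open U, is_interval U, U !=set0 & forall s, U s -> y0 < E al be s].
Proof.
case=> [[-> _ _ h]|[k [-> _ _ h _]]|[k [-> _ _ h _]]].
- by split => //; [exact: openT | exists 0].
- split; [exact: interval_open | exact: interval_is_interval | |].
    by exists (k + 1); rewrite /= in_itv /= ltrDl ltr01.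
  by move=> s; rewrite /= in_itv /= andbT; exact: h.
- split; [exact: interval_open | exact: interval_is_interval | |].
    by exists (k - 1); rewrite /= in_itv /= gtrDl ltrN10.
  by move=> s; rewrite /= in_itv /=; exact: h.
Qed.

(** An interval reaching past a finite end [k] would contain [k], where the combination is not above
    [y0]. *)
Lemma positivity_component_max al be y0 U M : positivity_component n c al be y0 U ->
  is_interval M -> U `<=` M -> (forall s, M s -> y0 < E al be s) -> M = U.
Proof.
move=> CU iM UM hM; apply/seteqP; split => // s Ms; move: CU UM.
case=> [[-> //]|[k [-> _ Ek _ _]]|[k [-> _ Ek _ _]]] UM; rewrite /= in_itv /= ?andbT ltNge;
  apply/negP => sk; suff /hM : M k by rewrite Ek ltxx.
- apply: iM Ms (UM (k + 1) _) _ _; first by rewrite /= in_itv /= ltrDl ltr01.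
  by rewrite sk lerDl ler01.
- apply: iM (UM (k - 1) _) Ms _ _; first by rewrite /= in_itv /= gtrDl ltrN10.
  by rewrite sk andbT gerDl lerN10.
Qed.

(** The extension is [T \o E al be] on the whole component. A further extension is again given by
    exponentials, whose coefficients agree already on [U], so its domain satisfies the same
    positivity and cannot be larger. *)
Lemma exists_maximal_extension L f s0 : profile_solution w n c L f -> L s0 ->
    1 - derive1 f s0 ^+ 2 / b (f s0) ^+ 2 != 0 ->
  exists M F, maximal_extension w n c L f M F.
Proof.
move=> sol Ls0 ns0; have [al [be h]] := profile_exp_comb hn hc sol.
have [oL iL L0 sol'] := sol.
have If s : L s -> warp_dom w c (f s) by move=> /sol'[].
have albe : al * be != 0.
  by apply: contraNneq ns0 => e; rewrite (h _ Ls0).2 -(mulrA 4) e mulr0 mul0r.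
have hL s : L s -> warp_bot w < E al be s.
  by move=> Ls; rewrite -(h _ Ls).1; apply: warp_prim_gt => //; exact: If.
have [U LU CU] := exp_comb_component hn hc iL L0 (warp_bot_ge0 w) albe hL.
have [oU iU U0 hU] := positivity_componentP CU.
exists U, (T \o E al be); split => //.
- exact: profile_solution_warp_inv.
- by move=> s Ls /=; rewrite -(h _ Ls).1 warp_invK //; exact: If.
move=> M g gsol UM gE; have [al' [be' g']] := profile_exp_comb hn hc gsol.
have [_ iM _ gsol'] := gsol.
have eqE s : U s -> E al be s = E al' be' s.
  move=> Us; rewrite -(g' _ (UM _ Us)).1 gE //=.
  by have [_ ->] := warp_invP hn hc (hU _ Us).
have [alE beE] := exp_comb_inj hn hc oU U0 eqE; rewrite -alE -beE in g'.
apply: (positivity_component_max CU) => // s Ms.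
by rewrite -(g' _ Ms).1; apply: warp_prim_gt => //; case: (gsol' _ Ms).
Qed.

(** The solution on the component containing [M] extends [F], so maximality makes [M] the entire
    component. *)
Lemma maximal_extension_exp_comb L f s0 M F : L s0 -> open L ->
    1 - derive1 f s0 ^+ 2 / b (f s0) ^+ 2 != 0 ->
    maximal_extension w n c L f M F ->
  exists al be, [/\ al * be != 0, positivity_component n c al be (warp_bot w) M &
    forall s, M s -> F s = T (E al be s) /\
      1 - derive1 F s ^+ 2 / b (F s) ^+ 2 = 4 * al * be / E al be s ^+ 2].
Proof.
move=> Ls0 oL ns0 [sol LM FE maxM]; have [al [be h]] := profile_exp_comb hn hc sol.
have [oM iM M0 sol'] := sol.
have IF s : M s -> warp_dom w c (F s) by move=> /sol'[].
have dE : derive1 F s0 = derive1 f s0.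
  rewrite !derive1E; apply: near_eq_derive.
  have : \forall s \near s0, L s by apply: open_nbhs_nbhs.
  by apply: filterS => s; exact: FE.
have albe : al * be != 0.
  apply: contraNneq ns0 => e.
  by rewrite -dE -FE // (h _ (LM _ Ls0)).2 -(mulrA 4) e mulr0 mul0r.
have hM s : M s -> warp_bot w < E al be s.
  by move=> Ms; rewrite -(h _ Ms).1; apply: warp_prim_gt => //; exact: IF.
have TE s : M s -> T (E al be s) = F s.
  by move=> Ms; rewrite -(h _ Ms).1 warp_invK //; exact: IF.
have [U MU CU] := exp_comb_component hn hc iM M0 (warp_bot_ge0 w) albe hM.
have [oU iU U0 hU] := positivity_componentP CU.
have UM : U = M.
  by apply: (maxM U (T \o E al be)) => //; exact: profile_solution_warp_inv.
exists al, be; split; rewrite -?UM // => s; rewrite UM => Ms.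
by rewrite TE // (h _ Ms).2 (h _ Ms).1.
Qed.

Lemma warp_inv_lt y t : warp_bot w < y -> warp_dom w c t ->
  match w with II => (y < Z t -> t < T y) /\ (Z t < y -> T y < t)
             | III => (y < Z t -> T y < t) /\ (Z t < y -> t < T y) end.
Proof.
move=> /(warp_invP hn hc)[IT ZT] It.
have := warp_prim_lt hn hc IT It; have := warp_prim_lt hn hc It IT; rewrite ZT.
move: IT ZT; case: w => IT ZT h1 h2; split=> hy;
  case: (ltgtP (warp_inv _ n c y) t) => // xt.
- by have := h2 xt; rewrite ltNge ltW.
- by move: hy; rewrite -xt ZT ltxx.
- by have := h1 xt; rewrite ltNge ltW.
- by move: hy; rewrite -xt ZT ltxx.
- by have := h1 xt; rewrite ltNge ltW.
- by move: hy; rewrite -xt ZT ltxx.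
- by have := h2 xt; rewrite ltNge ltW.
- by move: hy; rewrite -xt ZT ltxx.
Qed.

Lemma warp_inv_near0 e : 0 < e ->
  exists eta, forall y, eta < y -> warp_bot w < y -> `|T y| < e.
Proof.
move=> e0; have inv := @warp_inv_lt; have invP y := @warp_invP R w n c hn hc y.
move: inv invP; case: w => inv invP.
  have p0 : 0 < pi / (2 * c) by rewrite divr_gt0 ?pi_gt0 ?mulr_gt0.
  pose t := Num.min e (pi / (2 * c)) / 2.
  have m0 : 0 < Num.min e (pi / (2 * c)) by rewrite lt_min e0.
  have m1 : Num.min e (pi / (2 * c)) <= e by rewrite ge_min lexx.
  have m2 : Num.min e (pi / (2 * c)) <= pi / (2 * c) by rewrite ge_min lexx orbT.
  have It : warp_dom II c t by rewrite /= in_itv /= /t; lra.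
  exists (warp_prim II n c t) => y ty hy.
  have [/= /itvP IT _] := invP _ hy; rewrite gtr0_norm ?IT //.
  by have := (inv _ _ hy It).2 ty; rewrite /t; lra.
have It : warp_dom III c (- e) by rewrite /= in_itv /= oppr_lt0.
exists (warp_prim III n c (- e)) => y ty hy.
have [/= /itvP IT _] := invP _ hy; rewrite ltr0_norm ?IT // ltrNl.
exact: (inv _ _ hy It).2.
Qed.

(** The end of I at which [Z] tends to [warp_bot], hence the target of the blow-up. *)
Definition warp_end (w : warp) : set_system R :=
  match w with II => nbhs (pi / (2 * c)) | III => -oo end.

Lemma warp_inv_end (P : set R) : warp_end w P ->
  exists2 eta, warp_bot w < eta & forall y, warp_bot w < y < eta -> P (T y).
Proof.
have inv := @warp_inv_lt; have invP y := @warp_invP R w n c hn hc y.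
have gtZ t := @warp_prim_gt R w n c hn hc t.
move: inv invP gtZ; case: w => inv invP gtZ /=.
  have p0 : 0 < pi / (2 * c) by rewrite divr_gt0 ?pi_gt0 ?mulr_gt0.
  move=> /nbhs_ballP[e /= e0 eP].
  pose t := pi / (2 * c) - Num.min e (pi / (2 * c)) / 2.
  have m0 : 0 < Num.min e (pi / (2 * c)) by rewrite lt_min e0.
  have m1 : Num.min e (pi / (2 * c)) <= e by rewrite ge_min lexx.
  have m2 : Num.min e (pi / (2 * c)) <= pi / (2 * c) by rewrite ge_min lexx orbT.
  have It : warp_dom II c t by rewrite /= in_itv /= /t; lra.
  exists (warp_prim II n c t); first exact: gtZ.
  move=> y /andP[hy yt]; apply: eP; rewrite /ball /=.
  have [/= /itvP IT _] := invP _ hy; rewrite gtr0_norm ?subr_gt0 ?IT //.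
  by have := (inv _ _ hy It).1 yt; rewrite /t; lra.
move=> [M [_ MP]].
have It : warp_dom III c (Num.min M (- 1)) by rewrite /= in_itv /= gt_min ltrN10 orbT.
exists (warp_prim III n c (Num.min M (- 1))); first exact: gtZ.
move=> y /andP[hy yt]; apply: MP.
apply: lt_le_trans ((inv _ _ hy It).1 yt) _.
by rewrite ge_min lexx.
Qed.

Lemma exp_comb_pinfty al be (eta : R) : 0 < al -> \forall s \near +oo, eta < E al be s.
Proof.
move=> al0; near=> s.
have s0 : 0 < s by near: s; exact: nbhs_pinfty_gt (num_real _).
(* For s > 0 the second term is at least -|be| and e^(as) >= 1 + as, so this threshold makes the
   first term win. *)
have s1 : (eta + `|be|) / (al * a) < s by near: s; exact: nbhs_pinfty_gt (num_real _).
rewrite /exp_comb -/a; rewrite ltr_pdivrMr ?(mulr_gt0 al0 a0) // in s1.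
have e1 : 1 + a * s <= expR (a * s) by exact: expR_ge1Dx.
have e2 : - `|be| <= be * expR (- (a * s)).
  rewrite lerNl -mulNr; apply: le_trans (ler_norm _) _.
  rewrite normrM normrN ler_piMr // ger0_norm ?expR_ge0 // -[leRHS]expR0 ler_expR.
  by rewrite oppr_le0 mulr_ge0 // ltW.
have e3 : al * (1 + a * s) <= al * expR (a * s) by rewrite ler_pM2l.
by nra.
Unshelve. all: by end_near. Qed.

Lemma exp_comb_ninfty al be (eta : R) : 0 < be -> \forall s \near -oo, eta < E al be s.
Proof.
move=> be0; have [M [_ hM]] := exp_comb_pinfty al eta be0.
exists (- M); split; first exact: num_real.
by move=> s sM; rewrite -[s]opprK exp_combN; apply: hM; rewrite ltrNr.
Qed.

(** The minimum is where both terms are equal, e^(2as) = be / al; the excess elsewhere is a square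
    over e^(as). *)
Lemma exp_comb_min al be : 0 < al -> 0 < be ->
  exists s0, forall s, E al be s0 <= E al be s.
Proof.
move=> al0 be0; exists (ln (be / al) / (2 * a)) => s; rewrite /exp_comb -/a !expRN.
have : expR (a * (ln (be / al) / (2 * a))) ^+ 2 = be / al.
  rewrite -expRM_natl -[RHS]lnK ?posrE ?divr_gt0 //; congr expR; field.
  by rewrite !gt_eqF.
move: (expR_gt0 (a * s)) (expR_gt0 (a * (ln (be / al) / (2 * a)))).
move: (expR _) (expR _) => z x x0 z0 z2.
have beE : be = al * z ^+ 2 by rewrite z2 mulrC divfK // gt_eqF.
rewrite beE -subr_ge0.
have -> : al * x + al * z ^+ 2 / x - (al * z + al * z ^+ 2 / z) = al * (x - z) ^+ 2 / x.
  by field; rewrite !gt_eqF.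
exact: divr_ge0 (mulr_ge0 (ltW al0) (sqr_ge0 _)) (ltW x0).
Qed.

Lemma half_line_blow_up_right al be k F : 0 < al -> E al be k = warp_bot w ->
    (forall s, k < s -> warp_bot w < E al be s) ->
    (forall s, k < s -> F s = T (E al be s)) ->
  half_line_blow_up (warp_end w) `]k, +oo[ F.
Proof.
move=> al0 Ek hE FE; exists k; split.
  move=> P /warp_inv_end[eta heta hP].
  have : \forall s \near k, E al be s < eta.
    have cE : {for k, continuous (E al be)}.
      apply/differentiable_continuous/derivable1_diffP.
      by case: (is_derive_exp_comb n c al be k).
    by apply: (cvgr_lt _ cE); rewrite Ek.
  apply: filterS => s sE; rewrite /= in_itv /= andbT => ks.
  by rewrite FE //; apply: hP; rewrite hE.
right; split => //; apply/cvgrPdist_lt => e /warp_inv_near0[eta heta].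
near=> s; have ks : k < s by near: s; exact: nbhs_pinfty_gt (num_real _).
rewrite sub0r normrN FE //; apply: heta; last exact: hE.
by near: s; exact: exp_comb_pinfty.
Unshelve. all: by end_near. Qed.

Lemma half_line_blow_up_left al be k F : 0 < be -> E al be k = warp_bot w ->
    (forall s, s < k -> warp_bot w < E al be s) ->
    (forall s, s < k -> F s = T (E al be s)) ->
  half_line_blow_up (warp_end w) `]-oo, k[ F.
Proof.
move=> be0 Ek hE FE; exists k; split.
  move=> P /warp_inv_end[eta heta hP].
  have : \forall s \near k, E al be s < eta.
    have cE : {for k, continuous (E al be)}.
      apply/differentiable_continuous/derivable1_diffP.
      by case: (is_derive_exp_comb n c al be k).
    by apply: (cvgr_lt _ cE); rewrite Ek.
  apply: filterS => s sE; rewrite /= in_itv /= => ks.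
  by rewrite FE //; apply: hP; rewrite hE.
left; split => //; apply/cvgrPdist_lt => e /warp_inv_near0[eta heta].
near=> s; have ks : s < k by near: s; exact: nbhs_ninfty_lt (num_real _).
rewrite sub0r normrN FE //; apply: heta; last exact: hE.
by near: s; exact: exp_comb_ninfty.
Unshelve. all: by end_near. Qed.

Lemma entire_vanishing_warp_inv al be F : 0 < al -> 0 < be ->
    (forall s, warp_bot w < E al be s) -> (forall s, F s = T (E al be s)) ->
  entire_vanishing setT F.
Proof.
move=> al0 be0 hE FE; split => //; apply/cvgrPdist_lt => e /warp_inv_near0[eta heta].
  near=> s; rewrite sub0r normrN FE //; apply: heta => //.
  by near: s; exact: exp_comb_ninfty.
near=> s; rewrite sub0r normrN FE //; apply: heta => //.
by near: s; exact: exp_comb_pinfty.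
Unshelve. all: by end_near. Qed.

(** II.B and II.C are both spacelike; only their domains separate them. *)
Lemma setT_neq_half_line (l : set_system R) F L : half_line_blow_up l L F -> L <> setT.
Proof.
case=> k [_ [[-> _]|[-> _]]] LT; have : [set: R] k by []; rewrite -LT /= in_itv /= ?ltxx //.
Qed.

Lemma in_exactly_one_class_exp_comb al be L F : al * be != 0 ->
    positivity_component n c al be (warp_bot w) L ->
    (forall s, L s -> F s = T (E al be s) /\
      1 - derive1 F s ^+ 2 / b (F s) ^+ 2 = 4 * al * be / E al be s ^+ 2) ->
  in_exactly_one_class n c w L F.
Proof.
move=> albe CL FE; have [oL iL [s0 Ls0] hE] := positivity_componentP CL.
have E2 s : L s -> 0 < E al be s ^+ 2.
  by move=> Ls; rewrite exprn_gt0 // (le_lt_trans (warp_bot_ge0 w)) ?hE.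
have tl : al * be < 0 -> timelike w n c L F.
  move=> h s Ls; rewrite -/b (FE _ Ls).2 -(mulrA 4) pmulr_llt0 ?invr_gt0 ?E2 //.
  by rewrite pmulr_rlt0.
have sl : 0 < al * be -> spacelike w n c L F.
  move=> h s Ls; rewrite -/b (FE _ Ls).2 -(mulrA 4) pmulr_lgt0 ?invr_gt0 ?E2 //.
  by rewrite pmulr_rgt0.
have tsl : ~ (timelike w n c L F /\ spacelike w n c L F).
  by move=> [/(_ _ Ls0) h1 /(_ _ Ls0) h2]; have := lt_trans h1 h2; rewrite ltxx.
have cases : (half_line_blow_up (warp_end w) L F /\ (0 < al * be -> (0 : R) < warp_bot w)) \/
     [/\ entire_vanishing L F, 0 < al * be & match w with
         II => exists s0, forall s, F s <= F s0
       | III => exists s0, forall s, F s0 <= F s end].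
    case: CL => [[LT al0 be0 h]|[k [LE al0 Ek h h']]|[k [LE be0 Ek h h']]].
    - right; have FT s : F s = T (E al be s) by apply: (FE _ _).1; rewrite LT.
      split; [|exact: mulr_gt0|].
        by rewrite LT; apply: entire_vanishing_warp_inv FT.
      have [s1 hs1] := exp_comb_min al0 be0.
      (* [Z] reverses the order for II and preserves it for III, so the minimum of the combination
         becomes a maximum or a minimum of [F]. *)
      have mono s : match w with II => F s <= F s1 | III => F s1 <= F s end.
        have [IT ZT] := warp_invP hn hc (h s); have [IT1 ZT1] := warp_invP hn hc (h s1).
        move: (hs1 s); rewrite -{1}ZT1 -{1}ZT -!FT => hZ.
        have := warp_prim_lt hn hc IT IT1; have := warp_prim_lt hn hc IT1 IT.
        rewrite -!FT; move: hZ; case: w => hZ h1 h2; rewrite leNgt; apply/negP.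
          by move=> /h1; rewrite ltNge hZ.
        by move=> /h2; rewrite ltNge hZ.
      by move: mono; case: w => mono; exists s1.
    - left; split; [|exact: h']; rewrite LE; apply: half_line_blow_up_right al0 Ek h _ => s ks.
      by apply: (FE _ _).1; rewrite LE /= in_itv /= ks.
    - left; split; [|exact: h']; rewrite LE; apply: half_line_blow_up_left be0 Ek h _ => s ks.
      by apply: (FE _ _).1; rewrite LE /= in_itv /= ks.
have half_entire l : half_line_blow_up l L F -> ~ entire_vanishing L F.
  by move=> /setT_neq_half_line hL [].
have {albe} : al * be < 0 \/ 0 < al * be.
  by case: ltgtP albe => // h _; [left | right].
move: tl sl tsl cases; case: w => tl sl tsl cases sgn /=.
  split; last first.
    split=> [[[h1 _] [h2 _ _]]|[[h1 _] [h2 _]]|[[_ h1 _] [_ h2]]].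
    - exact: tsl.
    - exact: tsl.
    - exact: half_entire h2 h1.
  case: cases => [[hb _]|[ev ab mx]].
    by case: sgn => h; [apply: Or31 | apply: Or33]; split; auto.
  by apply: Or32; split; auto.
split; last by move=> [[h1 _] [h2 _ _]]; exact: tsl.
case: cases => [[hb h0]|[ev ab mx]]; last by right; split; auto.
(* For III a spacelike half-line would need 0 < [warp_bot III], which is 0. *)
case: sgn => [h|/h0]; last by rewrite ltxx.
by left; split; auto.
Qed.

End Classify.

Theorem theorem4p15 (R : realType) (n : nat) (hn : (1 <= n)%N)
  (c : R) (hc : 0 < c)
  (P : riemannianManifold R n.-1) (hP : [set: P] !=set0)
  (w : warp) (L' : set R) (f : R -> R)
  (hL'open : open L') (hL'itv : is_interval L') (hL'0 : L' !=set0)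
  (hf : Xsoliton (prodLine P) (warp_dom w c) (warp_fun w n c)
          [set x : P * R | L' x.2] (fun x : P * R => f x.2)) :
  profile_solution w n c L' f /\
  (exists L F, maximal_extension w n c L' f L F) /\
  (forall L F, maximal_extension w n c L' f L F ->
     in_exactly_one_class n c w L F).
Proof.
have [p _] := hP.
have If s : L' s -> warp_dom w c (f s) by have [_ h _ _ _] := hf; exact: (h (p, s)).
have b0 s : L' s -> 0 < warp_fun w n c (f s) by move=> /If; exact: warp_fun_gt0.
have db s : L' s -> derivable (warp_fun w n c) (f s) 1.
  by move=> /If /(is_derive_warp_fun n hc)[].
have P1 s (Ls : L' s) := soliton_profile hP hL'open Ls (db s Ls) (b0 s Ls) hf.
have sol : profile_solution w n c L' f.
  split => // s Ls; have [_ df ddf _ ->] := P1 s Ls; split => //; first exact: If.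
  rewrite addn1 prednK // warp_cstE //; last exact: If.
  by field; rewrite gt_eqF ?b0.
have [s0 Ls0] := hL'0.
(* Nondegeneracy at a single point suffices: it gives [al * be != 0], which fixes the causal type on
   the whole interval. *)
have nz : 1 - derive1 f s0 ^+ 2 / warp_fun w n c (f s0) ^+ 2 != 0.
  have [_ _ _ h _] := P1 s0 Ls0.
  have B2 : warp_fun w n c (f s0) ^+ 2 != 0 by rewrite expf_neq0 // gt_eqF ?b0.
  rewrite subr_eq0 eq_sym; apply: contra h => /eqP h.
  by rewrite -(divfK B2 (derive1 f s0 ^+ 2)) h mul1r.
split => //; split; first exact: exists_maximal_extension sol Ls0 nz.
move=> L F /(maximal_extension_exp_comb hn hc Ls0 hL'open nz)[al [be [albe CL FE]]].
exact: in_exactly_one_class_exp_comb CL FE.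
Qed.
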